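(* Let $\Omega\subseteq\mathbb R^n$ be open and bounded, let $r>0$, and let $\mu$ denote Lebesgue measure. Suppose there exist a set $\Omega_0\subseteq\overline{\Omega}$ with $\mu(\Omega_0)>0$ and constants $\vartheta\in(0,1)$, $\eta_1,\eta_2,m,c\in(0,+\infty)$ and $p\in[1,+\infty)$ such that the functions $f\colon\overline{\Omega}\times[-r,r]\to[0,+\infty)$ and $k\colon\overline{\Omega}\times\overline{\Omega}\to\mathbb R$ satisfy: (1) $f$ satisfies the Carathéodory conditions: for every $u\in[-r,r]$ the function $t\mapsto f(t,u)$ is Lebesgue measurable; for a.e. $t\in\overline{\Omega}$ the function $u\mapsto f(t,u)$ is continuous; and there is a Lebesgue measurable $g_r\colon\overline{\Omega}\to[0,+\infty)$ such that for a.e. $t\in\overline{\Omega}$, $f(t,u)\le g_r(t)$ for all $u\in[-r,r]$; (2) for a.e. $t\in\Omega_0$, $\inf\{f(t,u): \vartheta m\mu(\Omega_0)^{-1/p}\le|u|\le r\}\ge\eta_1$; (3) $k$ is Lebesgue measurable on $\overline{\Omega}\times\overline{\Omega}$, for every $\tau\in\overline{\Omega}$ the function $s\mapsto k(\tau,s)$ is Lebesgue measurable on $\overline{\Omega}$, and $\lim_{t\to\tau}\int_{\overline{\Omega}}|k(t,s)-k(\tau,s)|g_r(s)\,ds=0$ for every $\tau\in\overline{\Omega}$; (4) there is a Lebesgue measurable $\Phi\colon\overline{\Omega}\to[0,+\infty)$ with $\Phi(t)\ge\eta_2$ for a.e. $t\in\Omega_0$; for every $t\in\overline{\Omega}$,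 $|k(t,s)|\le\Phi(s)$ for a.e. $s\in\overline{\Omega}$; and $c\,\Phi(s)\le\int_{\Omega_0}k(t,s)\,dt$ for a.e. $s\in\overline{\Omega}$; (5) $\int_{\overline{\Omega}}\Phi(s)g_r(s)\,ds<+\infty$; (6) $0<m\le rc\,\mu(\Omega_0)^{-1/q}$, where $q\in(1,+\infty]$ satisfies $p^{-1}+q^{-1}=1$. Then there exists $\lambda>0$ such that the Hammerstein integral equation $\lambda x(t)=\int_{\overline{\Omega}}k(t,s)f(s,x(s))\,ds$, $t\in\overline{\Omega}$, admits a continuous solution $x\colon\overline{\Omega}\to[-r,r]$ with $\bigl(\int_{\Omega_0}|x(t)|^p\,dt\bigr)^{1/p}=m$. *)

(* Defs.v *)
From HB Require Import structures.
From mathcomp Require Import all_boot all_order all_algebra.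
From mathcomp Require Import all_classical all_reals all_analysis.
Import Order.TTheory GRing.Theory Num.Theory.
Import numFieldNormedType.Exports.

Set Implicit Arguments.
Unset Strict Implicit.
Unset Printing Implicit Defensive.

Local Open Scope classical_set_scope.
Local Open Scope ring_scope.

(* n-dimensional Lebesgue measure on R^n = 'rV[R]_n, built as in the   *)
(* textbooks: Lebesgue outer measure (infimum of total volumes of      *)
(* countable covers by closed boxes), restricted to the sigma-algebra  *)
(* of Caratheodory-measurable sets (= Lebesgue measurable sets).       *)

(* An alias of a pointed type with the discrete (power set) sigma-algebra:
   only used to feed mathcomp's generic "outer measure from covers"
   construction [mu_ext], where covers then range over arbitrary sets. *)
Definition discr (T : Type) : Type := T.
HB.instance Definition _ (T : pointedType) := Pointed.on (discr T).
HB.instance Definition _ (T : pointedType) :=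
  @isMeasurable.Build default_measure_display (discr T)
    discrete_measurable discrete_measurable0
    discrete_measurableC discrete_measurableU.

Section LebesgueRn.
Variables (R : realType) (n : nat).

Definition box (a b : 'rV[R]_n) : set 'rV[R]_n :=
  [set x | forall i, a 0 i <= x 0 i <= b 0 i].

(* volume of the smallest enclosing box (0 for the empty set); on a
   nonempty box this is its usual volume *)
Definition box_hull_vol (A : set 'rV[R]_n) : \bar R :=
  if `[< A = set0 >] then 0%E
  else ereal_inf [set (\prod_(i < n) (ab.2 0 i - ab.1 0 i))%:E
                 | ab in [set ab : 'rV[R]_n * 'rV[R]_n | A `<=` box ab.1 ab.2]].

Lemma box_hull_vol0 : box_hull_vol set0 = 0%E.
Proof. by rewrite /box_hull_vol asboolT. Qed.

Lemma box_hull_vol_ge0 A : (0 <= box_hull_vol A)%E.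
Proof.
rewrite /box_hull_vol; case: asboolP => // A0.
apply: le_ereal_inf_tmp => _ [[a b] /= Aab <-].
have [x Ax] : exists x, A x.
  by apply: contra_notP A0 => nx; apply/seteqP; split => // y Ay; apply: nx; exists y.
rewrite lee_fin; apply: prodr_ge0 => i _.
by have /andP[h1 h2] := Aab x Ax i; rewrite subr_ge0 (le_trans h1 h2).
Qed.

Definition lebesgue_outer : set 'rV[R]_n -> \bar R :=
  @mu_ext _ (discr 'rV[R]_n) R box_hull_vol.

HB.instance Definition _ := isOuterMeasure.Build R 'rV[R]_n lebesgue_outer
  (@mu_ext0 _ (discr 'rV[R]_n) R box_hull_vol box_hull_vol0 box_hull_vol_ge0)
  (@mu_ext_ge0 _ (discr 'rV[R]_n) R box_hull_vol box_hull_vol_ge0)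
  (@le_mu_ext _ (discr 'rV[R]_n) R box_hull_vol)
  (@mu_ext_sigma_subadditive _ (discr 'rV[R]_n) R box_hull_vol box_hull_vol_ge0).

(* R^n with the Lebesgue sigma-algebra (convertible to 'rV[R]_n) *)
Definition lebesgue_outerO : {outer_measure set 'rV[R]_n -> \bar R} :=
  lebesgue_outer.
Definition LebRn : measurableType _ := caratheodory_type lebesgue_outerO.

Definition lebRn : {measure set LebRn -> \bar R} :=
  (lebesgue_outerO : set (caratheodory_type lebesgue_outerO) -> \bar R).

End LebesgueRn.

(* Main.v *)
(** Write [K] for the closure of [Om], [T x t] for the integral of
    [k t s * f s (x s)] over [K], [J x] for the integral of [|x|^p] over [Om0]
    and [mu0] for the measure of [Om0].  On the cone of continuous functions with
    [c * |x t| <= \int_Om0 x], Hoelder's inequality and (6) turn [J x <= m^p] into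
    [|x| <= r], and by Tonelli's theorem and (4) [T] maps the set [D] of such [x]
    into the cone.  As [c <= mu0], the constant function [1] lies in the cone,
    so [S x = T x + (m^p - J x)] does too; by (2) its integral over [Om0] is
    bounded below on [D], even where [T x] vanishes.  Hence
    [G x = m * S x / (J (S x))^(1/p)] is a compact self-map of the convex set
    [D], and Schauder's theorem gives [x = G x].  Then [J x = m^p], so that
    [S x = T x] and [lambda = (J (T x))^(1/p) / m].

    Schauder's theorem is reduced to Brouwer's on a simplex, which follows from
    Scarf's combinatorial lemma on dominant sets of grid points.  Tonelli's
    theorem for the Lebesgue (rather than product) sigma-algebra of [R^(n+n)]
    only needs that a Lebesgue measurable set is product measurable up to a set
    which is null for the product measure; this follows from covers by boxes. *)

Require Import Defs.
From mathcomp Require Import all_boot.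
From mathcomp Require Import zify.

Set Implicit Arguments.
Unset Strict Implicit.
Unset Printing Implicit Defensive.

(** * A combinatorial fixed point lemma *)

Section DominantSets.
Variables (T I : finType) (rk : I -> T -> nat).
Hypothesis rk_inj : forall i, injective (rk i).

Definition dominant (s : {set T}) :=
  [forall y, exists i, forall x in s, rk i y <= rk i x].

Lemma dominantP (s : {set T}) :
  reflect (forall y, exists i, forall x, x \in s -> rk i y <= rk i x)
          (dominant s).
Proof.
apply: (iffP forallP) => h y.
  by have /existsP[i /forall_inP hi] := h y; exists i.
by have [i hi] := h y; apply/existsP; exists i; apply/forall_inP.
Qed.

Lemma dominantS (s t : {set T}) : s \subset t -> dominant t -> dominant s.
Proof.
move=> st /dominantP h; apply/dominantP => y; have [i hi] := h y.
by exists i => x xs; apply: hi; apply: (subsetP st).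
Qed.

Definition lowest (x0 : T) (s : {set T}) (i : I) : T :=
  [arg min_(x < x0 in s) rk i x].

Lemma lowest_in x0 (s : {set T}) i : x0 \in s -> lowest x0 s i \in s.
Proof. by move=> h; rewrite /lowest; case: arg_minnP. Qed.

Lemma lowest_le x0 (s : {set T}) i x : x0 \in s -> x \in s -> rk i (lowest x0 s i) <= rk i x.
Proof. by move=> h xs; rewrite /lowest; case: arg_minnP => // z _ /(_ x xs). Qed.

Lemma lowestE x0 (s : {set T}) i z : x0 \in s -> z \in s ->
  (forall x, x \in s -> rk i z <= rk i x) -> lowest x0 s i = z.
Proof.
move=> h zs hz; apply: (@rk_inj i); apply/eqP; rewrite eqn_leq.
by rewrite lowest_le //= hz // lowest_in.
Qed.

Lemma imset_lowest x0 (s : {set T}) : dominant s -> x0 \in s ->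
  lowest x0 s @: [set: I] = s.
Proof.
move=> /dominantP ds x0s; apply/setP => y; apply/imsetP/idP => [[i _ ->]|ys].
  exact: lowest_in.
by have [i hi] := ds y; exists i => //; rewrite (lowestE x0s ys).
Qed.

(* The elements which may replace the lowest element of [t] for the order [a]. *)
Definition candidates (t : {set T}) (a : I) : {set T} :=
  [set y | [forall i, (i != a) ==> [exists x in t, rk i x < rk i y]]].

Lemma candidatesP (t : {set T}) a y : reflect
  (forall i, i != a -> exists2 x, x \in t & rk i x < rk i y)
  (y \in candidates t a).
Proof.
rewrite inE; apply: (iffP forallP) => h i.
  by move=> ia; have /implyP/(_ ia)/exists_inP := h i.
by apply/implyP => ia; apply/exists_inP; apply: h.
Qed.

Definition rooms_over (t : {set T}) :=
  [set s | [&& dominant s, #|s| == #|I| & t \subset s]].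

Lemma card_rooms_over (t : {set T}) x0 : dominant t -> x0 \in t ->
  #|t|.+1 = #|I| ->
  exists a b, [/\ a != b, lowest x0 t a = lowest x0 t b &
    #|rooms_over t| = (candidates t a != set0) + (candidates t b != set0)].
Proof.
move=> dt x0t ct; set f := lowest x0 t.
have fim : f @: [set: I] = t by exact: imset_lowest.
have : ~~ injectiveb f.
  apply/negP => /injectiveP fi; have := card_imset [set: I] fi.
  by rewrite fim cardsT -ct => h; lia.
case/injectivePn => a [b ab fab]; exists a, b; split => //.
have injC c d : c != d -> f c = f d -> {in [set~ c] &, injective f}.
  move=> cd fcd; apply/imset_injP.
  have -> : f @: [set~ c] = t.
    rewrite -fim; apply/setP => y; apply/imsetP/imsetP => [[i _ ->]|[i _ ->]].
      by exists i.
    case: (eqVneq i c) => [->|ic]; last by exists i; rewrite // !inE.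
    by exists d; rewrite // !inE eq_sym.
  by have := cardsC1 c; rewrite -ct => ->.
have inja := injC _ _ ab fab.
have injb : {in [set~ b] &, injective f} by apply: (injC _ a) => //; rewrite eq_sym.
have := candidatesP t; move: (candidates t) => cand candP.
have tops c : (cand c != set0) =
    #|[set x in cand c | [forall y in cand c, rk c y <= rk c x]]| :> nat.
  case: (set_0Vmem (cand c)) => [->|[z zc]].
    by rewrite eqxx; apply/esym/eqP; rewrite cards_eq0; apply/eqP/setP => x; rewrite !inE.
  have -> : cand c != set0 by apply/set0Pn; exists z.
  apply/esym/eqP/cards1P; exists [arg max_(x > z in cand c) rk c x].
  case: arg_maxnP => // x xc hx; apply/setP => y; rewrite !inE.
  apply/andP/eqP => [[yc /forall_inP hy]|->].
    by apply: (@rk_inj c); apply/eqP; rewrite eqn_leq hy // andbT; apply: hx.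
  by split; [|apply/forall_inP => w wc; apply: hx].
rewrite !tops {tops}.
set A := fun c => [set x in cand c | [forall y in cand c, rk c y <= rk c x]].
rewrite -/(A a) -/(A b).
have nt c d x : c != d -> f c = f d -> x \in cand c -> x \notin t.
  move=> cd fcd /candP xc; apply/negP => xt.
  have : x \in f @: [set: I] by rewrite fim.
  case/imsetP => i _ xE.
  have [ic|] := eqVneq i c; last first.
    move=> /xc [z zt]; rewrite xE ltnNge /f lowest_le //.
  have := xc d; rewrite eq_sym => /(_ cd)[z zt].
  by rewrite xE ic fcd ltnNge /f lowest_le.
have low c x i : x \in cand c -> i != c -> rk i (f i) < rk i x.
  move=> /candP h ic; have [z zt] := h i ic.
  by apply: leq_ltn_trans; apply: lowest_le.
have nota x : x \in cand a -> x \in cand b -> False.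
  move=> xa xb; have /dominantP/(_ x)[i hi] := dt.
  have : rk i x <= rk i (f i) by apply: hi; apply: lowest_in.
  rewrite leqNgt => /negP; apply.
  by case: (eqVneq i a) => [->|ia]; [apply: (low b)|apply: (low a)].
have up c x : x \in cand c -> rk c x <= rk c (f c).
  move=> xc; have /dominantP/(_ x)[i hi] := dt.
  have : rk i x <= rk i (f i) by apply: hi; apply: lowest_in.
  case: (eqVneq i c) => [->//|ic].
  by rewrite leqNgt (low c).
have isroom c d x : c != d -> f c = f d -> x \in A c -> x |: t \in rooms_over t.
  move=> cd fcd; rewrite inE => /andP[xc /forall_inP hx].
  have xt := nt _ _ _ cd fcd xc.
  rewrite inE cardsU1 xt add1n ct eqxx subsetUr !andbT.
  apply/dominantP => y; have [yc|] := boolP (y \in cand c).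
    exists c => z; rewrite !inE => /orP[/eqP->|zt]; first exact: hx.
    by apply: leq_trans (hx _ yc) (leq_trans (up _ _ xc) _); apply: lowest_le.
  have [/existsP[i /andP[ic /forall_inP hyt]] _|nex] :=
    boolP [exists i, (i != c) && [forall z in t, rk i y <= rk i z]]; last first.
    case/negP; apply/candP => i ic; move: nex; rewrite negb_exists => /forallP/(_ i).
    rewrite ic /= negb_forall => /existsP[z]; rewrite negb_imply -ltnNge => /andP[].
    by exists z.
  exists i.
  move=> z; rewrite !inE => /orP[/eqP->|]; last exact: hyt.
  by apply: leq_trans (hyt _ (lowest_in i x0t)) (ltnW (low _ _ _ xc ic)).
have AP : rooms_over t = [set x |: t | x in A a :|: A b].
  apply/setP => s; apply/idP/imsetP => [|[x]]; last first.
    by rewrite inE => /orP[] xA ->; [apply: (isroom a b)|apply: (isroom b a)];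
      rewrite // eq_sym.
  rewrite inE => /and3P[ds /eqP cs ts].
  have /cards1P[x sx] : #|s :\: t| == 1 by rewrite cardsD (setIidPr ts) cs -ct subSnn.
  have sE : s = x |: t by rewrite -(setID s t) (setIidPr ts) sx setUC.
  have xt : x \notin t by have := set11 x; rewrite -sx !inE => /andP[].
  have x0s : x0 \in s by rewrite sE !inE x0t orbT.
  have xs : x \in s by rewrite sE !inE eqxx.
  set h := lowest x0 s.
  have him : h @: [set: I] = s by exact: imset_lowest.
  have hinj : injective h.
    by move=> i j; apply: (imset_injP _) => //; rewrite him cs cardsT.
  have : x \in h @: [set: I] by rewrite him.
  case/imsetP => j _ xE.
  have hf i : i != j -> h i = f i.
    move=> ij; have hit : h i \in t.
      have := lowest_in i x0s; rewrite -/(h i) sE !inE => /orP[/eqP hx|//].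
      by rewrite xE in hx; move/hinj: hx ij => ->; rewrite eqxx.
    by apply/esym/lowestE => // y yt; apply: lowest_le => //; rewrite sE !inE yt orbT.
  have jab : (j == a) || (j == b).
    apply/norP => -[ja jb]; have : h a = h b by rewrite !hf // eq_sym.
    by move/hinj => /eqP; rewrite (negbTE ab).
  have xj : x \in cand j.
    apply/candP => i ij; exists (f i); first exact: lowest_in.
    rewrite ltn_neqAle -(hf _ ij) lowest_le // andbT.
    by apply: contraNneq ij => /rk_inj; rewrite {1}xE => /hinj ->.
  exists x => //.
  have : x \in A j.
    rewrite inE xj /=; apply/forall_inP => y yj.
    have /dominantP/(_ y)[i hi] := ds.
    have [<-|ij] := eqVneq i j; first exact: hi.
    have := hi _ (lowest_in i x0s); rewrite -/(h i) hf //.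
    by rewrite leqNgt (low j).
  by rewrite in_setU; case/orP: jab => /eqP-> ->; rewrite // orbT.
rewrite AP card_in_imset; last first.
  have nt' x : x \in A a :|: A b -> x \notin t.
    by rewrite !inE => /orP[]/andP[] hx _; [apply: (nt a b)|apply: (nt b a)];
      rewrite // eq_sym.
  move=> x y /nt' xt /nt' yt /setP/(_ x); rewrite !inE eqxx /= => /esym/orP[/eqP//|].
  by rewrite (negbTE xt).
rewrite cardsU; suff -> : A a :&: A b = set0 by rewrite cards0 subn0.
apply/setP => x; rewrite !inE; apply/negP => /andP[/andP[xa _] /andP[xb _]].
exact: (nota x).
Qed.

End DominantSets.

Section Scarf.
Variables (T I : finType) (rk : I -> T -> nat) (c : T -> I).
Hypothesis rk_inj : forall i, injective (rk i).

Let bound := (\max_(i : I) \max_(t : T) rk i t).+1.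

Let rk_lt_bound i t : rk i t < bound.
Proof.
rewrite ltnS (leq_trans _ (leq_bigmax i)) //.
exact: (leq_bigmax (F := fun t => rk i t) t).
Qed.

(* One slack element per order: [inr i] is the bottom of the order [i] and
   lies above all of [T] in the other orders, so that every dominant set can
   be completed by slacks to one having exactly [#|I|] elements. *)
Definition slack_rk (i : I) (x : T + I) : nat :=
  match x with
  | inl t => (rk i t).+1
  | inr j => if i == j then 0 else (bound + enum_rank j).+1
  end.

Definition slack_colour (x : T + I) : I :=
  match x with inl t => c t | inr j => j end.

Lemma slack_rk_inj i : injective (slack_rk i).
Proof.
move=> [t|j] [u|k] /=.
- by case=> /rk_inj ->.
- by case: eqP => // _ [] h; have := rk_lt_bound i t; lia.
- by case: eqP => // _ [] h; have := rk_lt_bound i u; lia.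
- case: (eqVneq i j) => [<-|ij]; case: (eqVneq i k) => [<-|ik] //.
  by case=> /addnI /val_inj /enum_rank_inj ->.
Qed.

(* Call a dominant set of [#|I|] elements a room, and a dominant set of one
   element less with all colours but [i0] a door. A door lies in exactly two
   rooms, except for the one made of slacks only, which lies in one; a room
   contains 0 or 2 doors unless it carries all the colours. *)
Theorem scarf (t0 : T) : 1 < #|I| ->
  exists (s : {set T}) (C : {set I}),
    (forall i, i \in C -> exists2 x, x \in s & c x = i) /\
    (forall y, exists2 i, i \in C & forall x, x \in s -> rk i y <= rk i x).
Proof.
move=> I1; have /card_gt0P[i0 _] : 0 < #|I| by apply: ltnW.
pose dom := dominant slack_rk.
suff [s [ds cs sI]] : exists s, [/\ dom s, #|s| = #|I| & slack_colour @: s = [set: I]].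
  have cinj : {in s &, injective slack_colour}.
    by apply/imset_injP; rewrite sI cs cardsT.
  exists [set t | inl t \in s], [set i | inr i \notin s]; split=> [i|y].
    rewrite inE => iC; have : i \in slack_colour @: s by rewrite sI.
    case/imsetP => -[t|j] js ji; last by move: iC; rewrite ji /= js.
    by exists t; rewrite ?inE.
  have /dominantP/(_ (inl y))[i hi] := ds; exists i.
    by rewrite inE; apply/negP => /hi /=; rewrite eqxx.
  by move=> x; rewrite inE => /hi /=.
have [/existsP[s /and3P[ds /eqP cs /eqP sI]]|noroom] := boolP [exists s : {set T + I},
  [&& dom s, #|s| == #|I| & slack_colour @: s == [set: I]]]; first by exists s.
exfalso.
pose D := [set t | [&& dom t, #|t|.+1 == #|I| & slack_colour @: t == ~: [set i0]]].
pose R := [set s | dom s && (#|s| == #|I|)].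
pose t1 : {set T + I} := inr @: ~: [set i0].
have doorinj t : t \in D -> {in t &, injective slack_colour}.
  rewrite inE => /and3P[_ /eqP ct /eqP tI]; apply/imset_injP.
  by have := cardsC1 i0; rewrite tI -ct => ->.
have even_rooms s : s \in R -> ~~ odd #|[set t in D | t \subset s]|.
  rewrite inE => /andP[ds /eqP cs].
  have [->|[t]] := set_0Vmem [set t in D | t \subset s]; first by rewrite cards0.
  rewrite inE => /andP[tD ts].
  have tinj := doorinj _ tD.
  have := tD; rewrite inE => /and3P[dt /eqP ct /eqP tI].
  have /cards1P[x sx] : #|s :\: t| == 1 by rewrite cardsD (setIidPr ts) cs -ct subSnn.
  have xt : x \notin t by have := set11 x; rewrite -sx !inE => /andP[].
  have sE : s = x |: t by rewrite -(setID s t) (setIidPr ts) sx setUC.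
  have xi0 : slack_colour x != i0.
    apply: contraNneq noroom => xi0; apply/existsP; exists s; rewrite ds cs eqxx /=.
    by rewrite sE imsetU1 tI xi0 setUCr.
  have : slack_colour x \in slack_colour @: t by rewrite tI !inE.
  case/imsetP => y yt cxy.
  have xy : x != y by apply: contraNneq xt => ->.
  have st : s :\ x = t by rewrite sE setU1K.
  have doorsub z : z \in s -> slack_colour @: (s :\ z) = ~: [set i0] ->
      s :\ z \in D.
    move=> zs h; have dz : dom (s :\ z) := dominantS (subsetDl _ _) ds.
    rewrite inE h eqxx andbT dz /=.
    by rewrite -cs (cardsD1 z s) zs.
  have ys : y \in s by rewrite sE !inE yt orbT.
  have sy : s :\ y \in D.
    apply: doorsub => //; rewrite -tI; apply/setP => i; apply/imsetP/imsetP => -[z].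
      rewrite sE !inE => /andP[zy /orP[/eqP->|zt] ->]; first by exists y.
      by exists z.
    move=> zt ->; have [->|zy] := eqVneq z y.
      by exists x; rewrite // !inE xy sE !inE eqxx.
    by exists z; rewrite // !inE zy sE !inE zt orbT.
  suff -> : [set t in D | t \subset s] = [set t; s :\ y].
    rewrite cards2; suff -> : t != s :\ y by [].
    by apply/eqP => /setP/(_ y); rewrite !inE eqxx yt.
  apply/setP => u; rewrite [LHS]inE in_set2.
  apply/andP/orP => [[uD us]|[/eqP->|/eqP->]] //; last first.
    by split=> //; apply: subsetDl.
  have /cards1P[z sz] : #|s :\: u| == 1.
    have := uD; rewrite inE => /and3P[_ /eqP cu _].
    by rewrite cardsD (setIidPr us) cs -cu subSnn.
  have uE : u = s :\ z by rewrite -sz setDDr setDv set0U (setIidPr us).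
  have [zx|zx] := eqVneq z x; first by left; rewrite uE zx st.
  have [zy|zy] := eqVneq z y; first by right; rewrite uE zy.
  have := doorinj _ uD x y; rewrite cxy uE sE !inE eqxx yt (eq_sym x) zx (eq_sym y) zy orbT.
  by move=> /(_ isT isT erefl) /eqP; rewrite (negbTE xy).
have t1D : t1 \in D.
  rewrite inE card_imset ?cardsC1; last by move=> ? ? [].
  rewrite prednK ?(ltnW I1) // eqxx -imset_comp /=.
  apply/andP; split; last first.
    by apply/eqP/setP => i; apply/imsetP/idP => [[j ? ->//]|hi]; exists i.
  apply/dominantP => -[t|j]; first exists i0 => x.
    case/imsetP => j; rewrite !inE => ji0 -> /=; rewrite eq_sym (negbTE ji0).
    by have := rk_lt_bound i0 t; lia.
  by exists j => x _ /=; rewrite eqxx.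
have cardI (t : {set T + I}) : #|t|.+1 = #|I| -> exists x, x \in t.
  by move=> ct; apply/set0Pn; rewrite -card_gt0; lia.
have even_doors t : t \in D -> t != t1 -> ~~ odd #|rooms_over slack_rk t|.
  move=> tD tt1; have := tD; rewrite inE => /and3P[dt /eqP ct /eqP tI].
  have [x0 x0t] := cardI _ ct.
  have [a [b [_ _ ->]]] := card_rooms_over slack_rk_inj dt x0t ct.
  have cne i : candidates slack_rk t i != set0.
    apply/set0Pn; exists (inr i); apply/candidatesP => j ji.
    have [/exists_inP//|] := boolP [exists x in t, slack_rk j x < slack_rk j (inr i)].
    rewrite negb_exists => /forallP h; case/negP: tt1.
    have tsub : t \subset inr @: ~: [set j].
      apply/subsetP => x xt; have := h x; rewrite xt /= (negbTE ji) -leqNgt.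
      case: x xt => [u|k] xt /=; first by have := rk_lt_bound j u; lia.
      case: eqP => [//|/eqP jk] _; apply: imset_f.
      by rewrite !inE eq_sym.
    have tE : t = inr @: ~: [set j].
      apply/eqP; rewrite eqEcard tsub card_imset ?cardsC1; last by move=> ? ? [].
      by rewrite -ct leqnn.
    have : j \in ~: (slack_colour @: t).
      rewrite tE -imset_comp /= inE; apply/negP => /imsetP[k].
      by rewrite !inE => /eqP jk /esym.
    by rewrite tI setCK inE tE /t1 => /eqP->.
  by rewrite !cne.
have odd_t1 : odd #|rooms_over slack_rk t1|.
  have := t1D; rewrite inE => /and3P[dt /eqP ct /eqP tI].
  have [x0 x0t] := cardI _ ct.
  have [a [b [ab lab ->]]] := card_rooms_over slack_rk_inj dt x0t ct.
  have int1 i : i != i0 -> inr i \in t1 by move=> ii0; apply: imset_f; rewrite !inE.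
  have lowi i : i != i0 -> lowest slack_rk x0 t1 i = inr i.
    by move=> ii0; apply: (lowestE slack_rk_inj) => //= [|x _]; rewrite ?int1 ?eqxx.
  have cand_i0 : candidates slack_rk t1 i0 != set0.
    apply/set0Pn; exists (inl t0); apply/candidatesP => i ii0.
    by exists (inr i); rewrite ?int1 //= eqxx.
  have cand_low d : d != i0 -> lowest slack_rk x0 t1 d = lowest slack_rk x0 t1 i0 ->
      candidates slack_rk t1 d = set0.
    move=> di0; rewrite lowi // => ld; apply/setP => y; rewrite [RHS]inE.
    apply/negP => /candidatesP h.
    have [z zt] : exists2 z, z \in t1 & slack_rk i0 z < slack_rk i0 y.
      by apply: h; rewrite eq_sym.
    have := lowest_le slack_rk i0 x0t zt; rewrite -ld.
    case: y h => [u|k] h /=; rewrite (eq_sym i0) (negbTE di0).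
      by have := rk_lt_bound i0 u; lia.
    case: eqP => [//|ki0] le1 le2; have [kd|kd] := eqVneq k d.
      by move: le1 le2; rewrite kd; lia.
    by have [w wt] := h k kd; rewrite /= eqxx.
  have [ai0|ai0] := eqVneq a i0.
    rewrite ai0 cand_i0 (cand_low b) ?eqxx //; first by rewrite -ai0 eq_sym.
    by rewrite -lab ai0.
  have [bi0|bi0] := eqVneq b i0.
    by rewrite bi0 cand_i0 (cand_low a) ?eqxx // lab bi0.
  by move: lab; rewrite !lowi // => -[] /eqP; rewrite (negbTE ab).
have cnt : \sum_(s in R) #|[set t in D | t \subset s]| = \sum_(t in D) #|rooms_over slack_rk t|.
  transitivity (\sum_(s in R) \sum_(t in D | t \subset s) 1).
    apply: eq_bigr => s _; rewrite -sum1_card; apply: eq_bigl => t.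
    by rewrite [LHS]inE.
  rewrite (exchange_big_dep (mem D)) //=; last by move=> ? ? _ /andP[].
  apply: eq_bigr => t tD; rewrite -sum1_card; apply: eq_bigl => s.
  by rewrite [RHS]inE [s \in R]inE tD -andbA.
have odd_sum (U : finType) (A : {set U}) (F : U -> nat) :
    (forall x, x \in A -> ~~ odd (F x)) -> ~~ odd (\sum_(x in A) F x).
  move=> h; elim/big_ind: _ => // m n /negbTE m0 /negbTE n0.
  by rewrite oddD m0 n0.
have := odd_sum _ R _ even_rooms; rewrite cnt (big_setD1 t1) //= oddD odd_t1 /=.
have := odd_sum _ (D :\ t1) (fun t => #|rooms_over slack_rk t|).
case: odd => // h _; suff: false by [].
by apply: h => t; rewrite in_setD1 => /andP[t1' tD]; apply: even_doors.
Qed.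

End Scarf.

(* The grid points of the simplex scaled by [N]; coordinate ties are broken by
   the enumeration rank, and [w] collects the coordinatewise minima of a
   colourful dominant set, which almost exhaust the total mass [N]. *)
Lemma scarf_grid d N (c : {ffun 'I_d -> 'I_N.+1} -> 'I_d) : 1 < d ->
  exists w : 'I_d -> nat,
    let near_w (z : {ffun 'I_d -> 'I_N.+1}) :=
      \sum_i z i = N /\ forall i, w i <= z i <= w i + d in
    (exists z, near_w z) /\
    forall i, w i = 0 \/ exists2 y, near_w y & c y = i.
Proof.
move=> d1; have d0 : 0 < d by lia.
pose i0 := Ordinal d0.
pose T : finType := {x : {ffun 'I_d -> 'I_N.+1} | \sum_i x i == N}.
pose rk (i : 'I_d) (x : T) := val x i * #|T| + enum_rank x.
have rk_inj i : injective (rk i).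
  move=> x y /(congr1 (modn^~ #|T|)); rewrite /rk !modnMDl !modn_small //.
  by move=> /val_inj /enum_rank_inj.
have t0P : \sum_i [ffun i => if i == i0 then ord_max else ord0 : 'I_N.+1] i == N.
  rewrite (bigD1 i0) //= ffunE eqxx big1 ?addn0 //.
  by move=> i /negbTE ii0; rewrite ffunE ii0.
pose mkT := exist (fun x : {ffun 'I_d -> 'I_N.+1} => \sum_i x i == N).
pose t0 : T := mkT _ t0P.
have [|s [C [sC sdom]]] := scarf (fun x : T => c (val x)) rk_inj t0.
  by rewrite card_ord.
have [i1 i1C _] := sdom t0.
have [x0 x0s _] := sC _ i1C.
have [low lowP] : exists low : 'I_d -> T, forall i, low i \in s /\
    forall x, x \in s -> val (low i) i <= val x i.
  exists (fun i => [arg min_(x < x0 in s) val x i]) => i.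
  by case: arg_minnP.
pose w i := if i \in C then val (low i) i : nat else 0.
have w_le x i : x \in s -> w i <= val x i.
  by move=> xs; rewrite /w; case: ifP => // _; apply: (lowP i).2.
have w_sum : N < \sum_(i in C) (w i).+1.
  rewrite ltnNge; apply/negP => le_wN.
  have le_w1 : \sum_(i in C | i != i1) (w i).+1 + (w i1).+1 <= N.
    by move: le_wN; rewrite (bigD1 i1) //= addnC.
  pose y0 (i : 'I_d) := if i == i1 then N - \sum_(j in C | j != i1) (w j).+1
    else if i \in C then (w i).+1 else 0.
  have y0w i : i \in C -> w i < y0 i.
    move=> iC; rewrite /y0 iC; case: eqP => [->|//]; lia.
  have sum_y0 : \sum_i y0 i = N.
    have yC : \sum_(i < d | i != i1) y0 i = \sum_(j in C | j != i1) (w j).+1.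
      rewrite [RHS]big_mkcondl; apply: eq_bigr => i /negbTE ii1.
      by rewrite /y0 ii1.
    by rewrite (bigD1 i1) //= yC /y0 eqxx; lia.
  have y0_lt i : y0 i < N.+1 by rewrite ltnS -sum_y0 (bigD1 i) //= leq_addr.
  have yP : \sum_i [ffun i => Ordinal (y0_lt i)] i == N.
    by apply/eqP; rewrite -[RHS]sum_y0; apply: eq_bigr => i _; rewrite ffunE.
  have [i iC hi] := sdom (mkT _ yP : T).
  have [lows _] := lowP i.
  have := hi _ lows; rewrite /rk /= ffunE /= leqNgt => /negP; apply.
  have := y0w i iC; rewrite /w iC => wy.
  have := ltn_ord (enum_rank (low i)) => lt_rk.
  have := leq_mul wy (leqnn #|T|); rewrite mulSn => h.
    apply: leq_trans (leq_trans h (leq_addr _ _)).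
    by rewrite addnC ltn_add2r.
have nearP x : x \in s -> \sum_i val x i = N /\ forall i, w i <= val x i <= w i + d.
  move=> xs; have /eqP sx := valP x; split=> // i.
  rewrite w_le //=.
  have : \sum_j val x j < \sum_j w j + d.
    rewrite sx; apply: leq_trans w_sum _.
    have -> : \sum_(j in C) (w j).+1 = \sum_(j in C) w j + #|C|.
      by rewrite -sum1_card -big_split /=; apply: eq_bigr => j _; rewrite addn1.
    apply: leq_add; first by rewrite [X in _ <= X](bigID (mem C)) /= leq_addr.
    by apply: leq_trans (max_card _) _; rewrite card_ord.
  rewrite (bigD1 i) //= [X in _ < X + _](bigD1 i) //=.
  have : \sum_(j | j != i) w j <= \sum_(j | j != i) val x j.
    by apply: leq_sum => j _; apply: w_le.
  by move=> /=; lia.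
exists w; split; first by exists (val x0); apply: nearP.
move=> i; have [iC|iC] := boolP (i \in C); last by left; rewrite /w (negbTE iC).
by right; have [x xs <-] := sC _ iC; exists (val x) => //; apply: nearP.
Qed.

From HB Require Import structures.
From mathcomp Require Import all_order all_algebra.
From mathcomp Require Import all_classical all_reals all_analysis measurable_realfun.
From mathcomp Require Import ring lra.
Import Order.TTheory GRing.Theory Num.Theory.
Import numFieldNormedType.Exports.

Local Open Scope classical_set_scope.
Local Open Scope ring_scope.

(** * Fixed point theorems *)

Lemma compact_seq_cluster (T : topologicalType) (A : set T) (u : nat -> T) :
  compact A -> (forall n, A (u n)) ->
  exists2 x, A x & forall U, nbhs x U -> forall N, exists2 n, (N <= n)%N & U (u n).
Proof.
move=> cA uA; have := cA (u @ \oo) _; case=> [|x [Ax cx]].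
  by exists 0%N => // n _; apply: uA.
exists x => // U Ux N.
have [_ [[n Nn <-] Uun]] : [set u n | n in [set n | (N <= n)%N]] `&` U !=set0.
  by apply: cx => //; exists N => // n /= Nn; exists n.
by exists n.
Qed.

Lemma within_continuous_dist (R : realType) (V : pseudoMetricType R) (A : set V)
    (f : V -> R) x e : {within A, continuous f} -> A x -> 0 < e ->
  exists2 d, 0 < d & forall y, A y -> ball x d y -> `|f x - f y| < e.
Proof.
move=> /subspace_continuousP/(_ x) /[apply] /cvgr_dist_lt /[apply].
by rewrite near_withinE => /nbhs_ballP[d d0 h]; exists d => // y Ay /h; apply.
Qed.

Section BrouwerSimplex.
Variables (R : realType) (d : nat).
Hypothesis d1 : (1 < d)%N.

Definition simplex : set 'rV[R]_d :=
  [set x | (forall i, 0 <= x 0 i) /\ \sum_i x 0 i = 1].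

Lemma simplex_compact : compact simplex.
Proof.
apply: (@subclosed_compact _ _ [set v : 'rV[R]_d | forall i, `[0, 1]%classic (v ord0 i)]).
- rewrite (_ : simplex = \bigcap_(i in [set: 'I_d]) [set x | 0 <= x 0 i] `&`
      [set x | \sum_i x 0 i = 1]); last first.
    apply/seteqP; split=> x [h s1]; split=> //; first by move=> i _; apply: h.
    by move=> i; apply: (h i).
  apply: closedI.
    apply: closed_bigI => i _.
    have /continuous_closedP := @coord_continuous R 1 d 0 i.
    by move=> /(_ _ (@closed_ge R 0)).
  have /continuous_closedP : continuous (fun x : 'rV[R]_d => \sum_i x 0 i).
    apply: continuous_big => [|i _]; [exact: add_continuous|exact: coord_continuous].
  by move=> /(_ _ (@closed_eq R 1)).
- by apply: (rV_compact (fun=> @segment_compact R 0 1)).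
- move=> x [x0 x1] i /=; rewrite in_itv /= x0 /= -x1 (bigD1 i) //=.
  by rewrite lerDl sumr_ge0.
Qed.

Variable F : 'I_d -> 'rV[R]_d -> R.
Hypothesis F_sum : forall x, simplex x -> \sum_i F i x = 1.

Lemma brouwer_approx (N : nat) : exists2 z, simplex z &
  forall i, z 0 i <= d%:R / N.+1%:R \/
    exists y, [/\ simplex y, forall j, `|z 0 j - y 0 j| <= d%:R / N.+1%:R &
      y 0 i <= F i y].
Proof.
pose pt (x : {ffun 'I_d -> 'I_N.+2}) : 'rV[R]_d := \row_i ((x i)%:R / N.+1%:R).
have N0 : 0 < N.+1%:R :> R by rewrite ltr0n.
have ptS (x : {ffun 'I_d -> 'I_N.+2}) : (\sum_i x i)%N = N.+1 -> simplex (pt x).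
  move=> sx; split=> [i|]; first by rewrite mxE divr_ge0 // ler0n.
  under eq_bigr do rewrite mxE.
  by rewrite -mulr_suml -natr_sum sx divff // lt0r_neq0.
have d0 : (0 < d)%N by apply: ltnW.
pose c (x : {ffun 'I_d -> 'I_N.+2}) := odflt (Ordinal d0) [pick i | pt x 0 i <= F i (pt x)].
have [w [[z [sz zw]] hw]] := scarf_grid c d1.
exists (pt z); first exact: ptS.
move=> i; have [wi0|[y [sy yw] cyi]] := hw i.
  left; rewrite mxE ler_pM2r ?invr_gt0 // ler_nat.
  by have := zw i; rewrite wi0 add0n => /andP[].
right; exists (pt y); split; first exact: ptS.
  move=> j; rewrite !mxE -mulrBl normrM [X in _ * X]ger0_norm ?invr_ge0 ?(ltW N0) //.
  rewrite ler_pM2r ?invr_gt0 //.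
  have /andP[z1 z2] := zw j; have /andP[y1 y2] := yw j.
  move: z1 z2 y1 y2; rewrite -!(ler_nat R) !natrD => z1 z2 y1 y2.
  by rewrite ler_norml; apply/andP; split; lra.
rewrite -cyi /c; case: pickP => //= no.
have [_ pty] := ptS _ sy; have := F_sum (ptS _ sy).
move/eqP; rewrite -pty eq_sym -subr_eq0 -sumrB => /eqP s0.
suff : 0 < \sum_i (pt y 0 i - F i (pt y)) by rewrite s0 ltxx.
rewrite (bigD1 (Ordinal d0)) //= ltr_pwDl ?sumr_ge0 // => [|j _].
  by rewrite subr_gt0 ltNge no.
by rewrite subr_ge0 ltW // ltNge no.
Qed.

Hypothesis F_ge0 : forall x, simplex x -> forall i, 0 <= F i x.
Hypothesis F_cont : forall i, {within simplex, continuous (F i)}.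

Theorem brouwer_simplex : exists2 x, simplex x & forall i, F i x = x 0 i.
Proof.
have [u uS] := choice (fun N => let: ex_intro2 z zS h := brouwer_approx N in
  ex_intro (fun z => simplex z /\ _) z (conj zS h)).
have [x xS clx] := compact_seq_cluster simplex_compact (fun N => (uS N).1).
have x_le i : x 0 i <= F i x.
  apply/ler_addgt0Pr => e3 e30; pose e := e3 / 3; have e0 : 0 < e by rewrite /e; lra.
  have [r r0 hr] := within_continuous_dist (@F_cont i) xS e0.
  pose q := Num.min (r / 2) e; have q0 : 0 < q by rewrite lt_min e0 andbT; lra.
  have qr : q <= r / 2 by rewrite ge_min lexx.
  have qe : q <= e by rewrite ge_min lexx orbT.
  have [M dM] : exists M, d%:R / M.+1%:R < q.
    exists (Num.truncn (d%:R / q)); rewrite ltr_pdivrMr ?ltr0n //.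
    by rewrite mulrC -ltr_pdivrMr // truncnS_gt.
  have [N MN xN] := clx _ (nbhsx_ballx x q q0) M.
  have dN : d%:R / N.+1%:R < q.
    apply: le_lt_trans dM; rewrite ler_wpM2l ?ler0n // lef_pV2 ?posrE ?ltr0n //.
    by rewrite ler_nat ltnS.
  have xuN j : `|x 0 j - u N 0 j| < q by apply: xN.2.
  have [_ /(_ i)[uNi|[y [yS yu yF]]]] := uS N.
    have F0 := F_ge0 xS i; have := xuN i; rewrite ltr_norml => /andP[h1 h2].
    have uq := le_lt_trans uNi dN.
    by rewrite /e in qe; clear -F0 h1 h2 qe uq e30; lra.
  have xy : ball x r y.
    split=> // k j; rewrite (ord1 k) /ball /= (le_lt_trans (ler_distD (u N 0 j) _ _)) //.
    have xj := xuN j; have yj := le_lt_trans (yu j) dN.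
    by clear -xj yj qr; lra.
  have := hr _ yS xy; rewrite ltr_norml => /andP[h1 h2].
  have := xuN i; rewrite ltr_norml => /andP[h3 h4].
  have := le_lt_trans (yu i) dN; rewrite ltr_norml => /andP[h5 h6].
  by rewrite /e in qe h1; clear -h1 h3 h4 h5 h6 qe yF; lra.
exists x => // i; apply/eqP; rewrite -subr_eq0; apply/eqP.
have s0 : \sum_i (F i x - x 0 i) = 0 by rewrite sumrB F_sum // xS.2 subrr.
by apply: (psumr_eq0P _ s0) => // j _; rewrite subr_ge0.
Qed.

End BrouwerSimplex.

Lemma finite_net (R : realType) (T : Type) (N : nat) (A : set T)
    (v : T -> 'I_N -> R) (M e : R) : A !=set0 -> 0 < e ->
  (forall x, A x -> forall j, `|v x j| <= M) ->
  exists d (z : 'I_d -> T), [/\ (1 < d)%N, forall i, A (z i) &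
    forall x, A x -> exists i, \sum_j `|v x j - v (z i) j| < e].
Proof.
move=> [x0 Ax0] e0 vM; pose h := e / N.+1%:R.
have h0 : 0 < h by rewrite divr_gt0 // ltr0n.
pose L := Num.truncn ((M + M) / h).
pose code x : {ffun 'I_N -> 'I_L.+1} := [ffun j => inord (Num.truncn ((v x j + M) / h))].
have codeE x j : A x -> code x j = Num.truncn ((v x j + M) / h) :> nat.
  move=> Ax; rewrite ffunE inordK // ltnS le_truncn // ler_pM2r ?invr_gt0 //.
  by rewrite lerD2r (le_trans (ler_norm _)) // vM.
have /choice[rep repP] (c : {ffun 'I_N -> 'I_L.+1}) : exists r,
    A r /\ (forall x, A x -> code x = c -> code r = c).
  have [[x [Ax xc]]|no] := pselect (exists x, A x /\ code x = c).
    by exists x.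
  by exists x0; split => // x Ax xc; case: no; exists x.
pose I : finType := (bool * {ffun 'I_N -> 'I_L.+1})%type.
exists #|I|, (fun i => rep (enum_val i).2); split.
- rewrite card_prod card_bool mul2n -addnn.
  have c0 : (0 < #|{ffun 'I_N -> 'I_L.+1}|)%N by apply/card_gt0P; exists (code x0).
  exact: (leq_add c0 c0).
- by move=> i; apply: (repP _).1.
move=> x Ax; exists (enum_rank ((true, code x) : I)); rewrite enum_rankK /=.
have [Ar /(_ x Ax erefl) rc] := repP (code x).
have lt_h j : `|v x j - v (rep (code x)) j| <= h.
  have := codeE _ j Ar; rewrite rc codeE // => tE.
  set a := (v x j + M) / h in tE; set b := (_ + M) / h in tE.
  have a0 : 0 <= a.
    by rewrite divr_ge0 ?(ltW h0) //; have := vM _ Ax j; rewrite ler_norml => /andP[? ?]; lra.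
  have b0 : 0 <= b.
    by rewrite divr_ge0 ?(ltW h0) //; have := vM _ Ar j; rewrite ler_norml => /andP[? ?]; lra.
  have -> : v x j - v (rep (code x)) j = (a - b) * h.
    by rewrite mulrBl !divfK ?lt0r_neq0 //; lra.
  rewrite normrM (gtr0_norm h0) ler_piMl ?(ltW h0) //.
  have /andP[a1 a2] := truncn_itv a0; have /andP[b1 b2] := truncn_itv b0.
  move: b1 b2 a2; rewrite -tE -!natr1 => b1 b2 a2.
  by rewrite ler_norml; apply/andP; split; clear -a1 a2 b1 b2; lra.
apply: le_lt_trans (ler_sum _ (fun j _ => lt_h j)) _.
rewrite sumr_const card_ord -mulr_natr /h mulrAC ltr_pdivrMr ?ltr0n //.
by rewrite ltr_pM2l // ltr_nat.
Qed.

Lemma nbhs_ptws_finite (R : realType) (X : choiceType) (N : nat) (ts : 'I_N -> X)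
    (y : prod_topology (fun _ : X => R)) (e : R) : 0 < e ->
  nbhs y [set h : prod_topology (fun _ : X => R) | forall j, ball (y (ts j)) e (h (ts j))].
Proof.
move=> e0.
have near_j j : nbhs y [set h : prod_topology (fun _ : X => R) | ball (y (ts j)) e (h (ts j))].
  exact: (@proj_continuous X (fun=> R) (ts j) y _ (nbhsx_ballx (y (ts j) : R) e e0)).
exact: (@filter_forall _ 'I_N (fun j (h : prod_topology (fun _ : X => R)) =>
  ball (y (ts j)) e (h (ts j))) (nbhs y) (nbhs_filter y) near_j).
Qed.

Section Schauder.
Variables (R : realType) (X : choiceType) (K : set X) (D : set (X -> R)).
Variables (G : (X -> R) -> X -> R) (M : R).
Hypothesis D_nonempty : D !=set0.
Hypothesis D_convex : forall d (l : 'I_d -> R) (y : 'I_d -> X -> R),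
  (forall i, 0 <= l i) -> \sum_i l i = 1 -> (forall i, D (y i)) ->
  D (fun t => \sum_i l i * y i t).
Hypothesis D_closed : forall x (u : nat -> X -> R), (forall n, D (u n)) ->
  (forall n t, K t -> `|u n t - x t| <= n.+1%:R^-1) -> D x.
Hypothesis G_D : forall x, D x -> D (G x).
Hypothesis G_bound : forall x, D x -> forall t, K t -> `|G x t| <= M.
Hypothesis G_equicontinuous : forall e : R, 0 < e ->
  exists N (ts : 'I_N -> X), (forall j, K (ts j)) /\ forall t, K t ->
    exists j, forall x, D x -> `|G x t - G x (ts j)| <= e.
Hypothesis G_continuous : forall x (u : nat -> X -> R), D x ->
  (forall n, D (u n)) ->
  (forall n t, K t -> `|u n t - x t| <= n.+1%:R^-1) ->
  forall t, K t -> G (u n) t @[n --> \oo] --> G x t.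

Lemma G_combination_continuous d (y : 'I_d -> X -> R) t :
  (forall i, D (y i)) -> (forall i s, K s -> `|y i s| <= M) -> K t ->
  {within @simplex R d,
     continuous (fun l : 'rV[R]_d => G (fun s => \sum_i l 0 i * y i s) t)}.
Proof.
move=> yD yM Kt; apply/subspace_continuousP => l lS /=.
set f := fun l : 'rV[R]_d => _.
have phiD (a : 'rV[R]_d) : @simplex R d a -> D (fun s => \sum_i a 0 i * y i s).
  by move=> [a0 a1]; apply: D_convex.
apply/cvgrPdist_lt => e e0; rewrite near_withinE; apply: contrapT => nfl.
pose q n : R := (n.+1%:R * (d%:R * `|M| + 1))^-1.
have q0 n : 0 < q n.
  by rewrite invr_gt0 mulr_gt0 ?ltr0n // ltr_wpDl // mulr_ge0.
have /choice[a aP] n : exists a,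
    [/\ @simplex R d a, ball l (q n) a & e <= `|f l - f a|].
  apply: contrapT => na; apply: nfl.
  apply/nbhs_ballP; exists (q n) => //= b lb bS; rewrite ltNge; apply/negP => eb.
  by apply: na; exists b.
have := G_continuous (phiD l lS) (fun n => phiD (a n) (let: And3 h _ _ := aP n in h)) _ Kt.
have dist n s : K s ->
    `|\sum_i a n 0 i * y i s - \sum_i l 0 i * y i s| <= n.+1%:R^-1.
  move=> Ks; rewrite -sumrB (le_trans (ler_norm_sum _ _ _)) //.
  have [_ [_ lan] _] := aP n.
  have le1 i : `|a n 0 i * y i s - l 0 i * y i s| <= q n * `|M|.
    rewrite -mulrBl normrM ler_pM // ?(le_trans (yM i s Ks)) ?ler_norm //.
    by rewrite distrC ltW //; apply: lan.
  rewrite (le_trans (ler_sum _ (fun i _ => le1 i))) // sumr_const card_ord.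
  have pos : 0 < d%:R * `|M| + 1 by rewrite ltr_wpDl // mulr_ge0.
  have -> : n.+1%:R^-1 = q n * (d%:R * `|M| + 1).
    by rewrite /q invfM divfK // lt0r_neq0.
  by rewrite -mulrnAr ler_pM2l // mulr_natl lerDl.
move=> /(_ dist) /cvgrPdist_lt /(_ _ e0) [n _ /(_ n (leqnn n)) /=].
by have [_ _ h] := aP n; rewrite ltNge h.
Qed.

Lemma schauder_approx e : 0 < e ->
  exists2 x, D x & forall t, K t -> `|G x t - x t| <= e.
Proof.
move=> e0; have e30 : 0 < e / 3 by rewrite divr_gt0.
have [N [ts [tsK tsP]]] := G_equicontinuous e30.
have [d [z [d1 zD zP]]] := finite_net (v := fun x j => G x (ts j)) D_nonempty e30
  (fun x Dx j => G_bound Dx (tsK j)).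
pose phi (l : 'rV[R]_d) t := \sum_i l 0 i * G (z i) t.
have phiD l : @simplex R d l -> D (phi l).
  by move=> [l0 l1]; apply: D_convex => // i; apply/G_D/zD.
pose a i x := e / 3 - \sum_j `|G x (ts j) - G (z i) (ts j)|.
pose w i x := `|a i x| + a i x.
have w0 i x : 0 <= w i x by rewrite /w -lerBlDr sub0r ler_normr lexx orbT.
pose W x := \sum_i w i x.
have W0 x : D x -> 0 < W x.
  move=> Dx; have [i hi] := zP x Dx.
  rewrite /W (bigD1 i) //= ltr_pwDl ?sumr_ge0 //.
  have ai : 0 < a i x by rewrite /a subr_gt0.
  by rewrite /w ltr_pwDr.
have Gphi_cont t : K t -> {within @simplex R d, continuous (fun l => G (phi l) t)}.
  move=> Kt; apply: G_combination_continuous => // i; first exact/G_D/zD.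
  by move=> s Ks; apply: G_bound.
have w_cvg i l : @simplex R d l ->
    w i (phi l') @[l' --> within (@simplex R d) (nbhs l)] --> w i (phi l).
  move=> lS; have a_cvg : a i (phi l') @[l' --> within (@simplex R d) (nbhs l)] --> a i (phi l).
    apply: cvgB; first exact: cvg_cst.
    apply: cvg_big => [|j _]; first exact: add_continuous.
    apply: cvg_norm; apply: cvgB; last exact: cvg_cst.
    by have /subspace_continuousP/(_ l lS) := Gphi_cont _ (tsK j).
  by apply: cvgD => //; apply: cvg_norm.
have [l lS lE] : exists2 l, @simplex R d l & forall i, w i (phi l) / W (phi l) = l 0 i.
  apply: (brouwer_simplex d1 (F := fun i l => w i (phi l) / W (phi l))).
  - by move=> l lS; rewrite -mulr_suml divff // lt0r_neq0 // W0 //; apply: phiD.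
  - by move=> l lS i; rewrite divr_ge0 // ltW // W0 //; apply: phiD.
  - move=> i; apply/subspace_continuousP => l lS /=.
    apply: cvgM; first exact: w_cvg.
    apply: cvgV; first by rewrite lt0r_neq0 // W0 //; apply: phiD.
    by apply: cvg_big => [|j _]; [exact: add_continuous|exact: w_cvg].
have [l0 l1] := lS.
exists (phi l); first exact: phiD.
move=> t Kt; have [j tj] := tsP t Kt.
have -> : G (phi l) t - phi l t = \sum_i l 0 i * (G (phi l) t - G (z i) t).
  under eq_bigr do rewrite mulrBr.
  by rewrite sumrB -mulr_suml l1 mul1r.
rewrite (le_trans (ler_norm_sum _ _ _)) //.
have le_e i : `|l 0 i * (G (phi l) t - G (z i) t)| <= l 0 i * e.
  rewrite normrM (ger0_norm (l0 i)).
  have := l0 i; rewrite le_eqVlt => /predU1P[<-|li0]; first by rewrite !mul0r.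
  rewrite ler_pM2l //.
  have : 0 < w i (phi l).
    rewrite lt0r w0 andbT; apply: contraTneq li0 => wi0.
    by rewrite -lE wi0 mul0r ltxx.
  rewrite /w; have [ai|ai] := leP (a i (phi l)) 0.
    by rewrite (ler0_norm ai) [X in 0 < X]addrC subrr ltxx.
  move=> _; move: ai; rewrite /a subr_gt0 => ai.
  have aj : `|G (phi l) (ts j) - G (z i) (ts j)| < e / 3.
    by apply: le_lt_trans ai; rewrite (bigD1 j) //= lerDl sumr_ge0.
  have := tj _ (phiD _ lS); have := tj _ (zD i); move: aj.
  rewrite !ler_norml !ltr_norml => /andP[h1 h2] /andP[h3 h4] /andP[h5 h6].
  by clear -h1 h2 h3 h4 h5 h6; lra.
rewrite (le_trans (ler_sum _ (fun i _ => le_e i))) // -mulr_suml l1 mul1r //.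
Qed.

Theorem schauder : exists2 x, D x & forall t, K t -> G x t = x t.
Proof.
have inv0 n : 0 < n.+1%:R^-1 :> R by rewrite invr_gt0 ltr0n.
have [x xP] := choice (fun n => let: ex_intro2 x Dx h := schauder_approx (inv0 n) in
  ex_intro (fun x => D x /\ _) x (conj Dx h)).
pose v n : prod_topology (fun _ : X => R) := fun t => if t \in K then G (x n) t else 0.
have boxC := @tychonoff X (fun=> R) (fun=> `[- `|M|, `|M|]%classic)
  (fun=> @segment_compact R _ _).
have [|y _ clv] := compact_seq_cluster (u := v) boxC.
  move=> n t /=; rewrite in_itv /= -ler_norml /v; case: ifPn => [|_]; last by rewrite normr0.
  by rewrite inE => Kt; rewrite (le_trans _ (ler_norm _)) // G_bound //; apply: (xP n).1.
have near_y I (ts : 'I_I -> X) e (N : nat) : 0 < e -> (forall j, K (ts j)) ->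
    exists2 n, (N <= n)%N & forall j, `|G (x n) (ts j) - y (ts j)| < e.
  move=> e0 tsK; have [n Nn hn] := clv _ (nbhs_ptws_finite ts y e0) N.
  by exists n => // j; have := hn j; rewrite /v mem_set // /ball /= distrC.
have unif e (N : nat) : 0 < e ->
    exists2 n, (N <= n)%N & forall t, K t -> `|G (x n) t - y t| <= e.
  move=> e0; have e50 : 0 < e / 5 by rewrite divr_gt0.
  have [I [ts [tsK tsP]]] := G_equicontinuous e50.
  have [n Nn hn] := near_y _ ts _ N e50 tsK.
  exists n => // t Kt; have [j tj] := tsP t Kt.
  have [k _ hk] : exists2 k, (0 <= k)%N & forall i : 'I_2,
      `|G (x k) (if i == ord0 then t else ts j) - y (if i == ord0 then t else ts j)| < e / 5.
    by apply: (near_y 2 (fun i : 'I_2 => if i == ord0 then t else ts j)) => // i; case: ifP.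
  have := hk ord0; have := hk ord_max; rewrite !eqxx /=.
  have := tj _ (xP n).1; have := tj _ (xP k).1; have := hn j.
  rewrite !ler_norml !ltr_norml.
  move=> /andP[h1 h2] /andP[h3 h4] /andP[h5 h6] /andP[h7 h8] /andP[h9 h10].
  by clear -h1 h2 h3 h4 h5 h6 h7 h8 h9 h10; apply/andP; split; lra.
have inv20 n : 0 < n.+1%:R^-1 / 2 :> R by rewrite divr_gt0.
have [s sP] := choice (fun n => let: ex_intro2 m h1 h2 := unif _ n.*2.+1 (inv20 n) in
  ex_intro (fun m => (n.*2.+1 <= m)%N /\ _) m (conj h1 h2)).
have ys n t : K t -> `|x (s n) t - y t| <= n.+1%:R^-1.
  move=> Kt; have [sn /(_ t Kt) h1] := sP n; have h2 := (xP (s n)).2 t Kt.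
  have h3 : (s n).+1%:R^-1 <= n.+1%:R^-1 / 2 :> R.
    rewrite -invfM lef_pV2 ?posrE ?mulr_gt0 ?ltr0n // -natrM ler_nat; lia.
  move: h1 h2 h3; move: (n.+1%:R^-1) ((s n).+1%:R^-1) => a b.
  rewrite !ler_norml => /andP[h1 h1'] /andP[h2 h2'] h3.
  by clear -h1 h1' h2 h2' h3; apply/andP; split; lra.
have yD : D y by apply: D_closed ys => n; apply: (xP _).1.
exists y => // t Kt.
have c1 := G_continuous yD (fun n => (xP (s n)).1) ys Kt.
have c2 : G (x (s n)) t @[n --> \oo] --> (y t : R).
  apply/cvgrPdist_le => e e0.
  exists (Num.truncn e^-1) => // n /= en; rewrite distrC.
  rewrite (le_trans ((sP n).2 t Kt)) //; apply: (@le_trans _ _ n.+1%:R^-1).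
    by rewrite ler_pdivrMr // ler_peMr // ?ler1n // ltW.
  rewrite invf_ple ?posrE ?ltr0n // ltW // (lt_le_trans (truncnS_gt _)) //.
  by rewrite ler_nat ltnS.
exact: (cvg_unique (@norm_hausdorff R R) c1 c2).
Qed.

End Schauder.

(** * Lebesgue measure on row vectors *)

Section LebesgueMeasurableSets.
Variables (R : realType) (n : nat).
Implicit Types (a b : 'rV[R]_n) (A : set 'rV[R]_n).

Definition vol a b : R := \prod_(i < n) (b 0 i - a 0 i).

Lemma box_hull_vol_le A a b : (forall i, a 0 i <= b 0 i) -> A `<=` box a b ->
  (box_hull_vol A <= (vol a b)%:E)%E.
Proof.
move=> ab Aab; rewrite /box_hull_vol; case: asboolP => [_|_].
  by rewrite lee_fin prodr_ge0 // => i _; rewrite subr_ge0.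
by apply: ereal_inf_lbound; exists (a, b).
Qed.

Lemma box_hull_volS A (B : set 'rV[R]_n) : A `<=` B ->
  (box_hull_vol A <= box_hull_vol B)%E.
Proof.
move=> AB; rewrite {1}/box_hull_vol; case: asboolP => [_|A0].
  exact: box_hull_vol_ge0.
rewrite /box_hull_vol asboolF; last first.
  by move=> B0; apply: A0; rewrite -subset0 -B0.
by apply: ereal_inf_le_tmp => _ [ab /= h <-]; exists ab => //= x /AB /h.
Qed.

Lemma lebesgue_outer_le_hull A : (lebesgue_outer A <= box_hull_vol A)%E.
Proof.
pose F (k : nat) : set 'rV[R]_n := if k is 0%N return set 'rV[R]_n then A else set0.
apply: ereal_inf_lbound; exists F.
  by split=> [[]// _|t Xt]; exists 0%N.
apply/cvg_lim => //; rewrite -cvg_shiftS.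
rewrite (_ : [sequence _]_n = cst (box_hull_vol A)); first exact: cvg_cst.
rewrite funeqE => k /=; rewrite big_nat_recl//= big1 ?adde0 // => i _.
exact: box_hull_vol0.
Qed.

Lemma box_hull_vol_split A i (x : R) (S := [set y : 'rV[R]_n | y 0 i <= x]) :
  (box_hull_vol (A `&` S) + box_hull_vol (A `&` ~` S) <= box_hull_vol A)%E.
Proof.
have [AS0|/set0P[y [Ay Sy]]] := eqVneq (A `&` S) set0.
  by rewrite AS0 box_hull_vol0 add0e box_hull_volS // => ? [].
have [AS0|/set0P[z [Az Sz]]] := eqVneq (A `&` ~` S) set0.
  by rewrite AS0 box_hull_vol0 adde0 box_hull_volS // => ? [].
rewrite {3}/box_hull_vol asboolF; last by move=> A0; move: Ay; rewrite A0.
apply: le_ereal_inf_tmp => _ [[a b] /= Aab <-].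
pose up (u : 'rV[R]_n) := \row_j if j == i then x else u 0 j.
have upi u : up u 0 i = x by rewrite mxE eqxx.
have upj u j : j != i -> up u 0 j = u 0 j by move=> /negbTE ji; rewrite mxE ji.
have ab j : a 0 j <= b 0 j.
  by have /andP[h1 h2] := Aab y Ay j; apply: le_trans h2.
have ax : a 0 i <= x by have /andP[h1 h2] := Aab y Ay i; apply: le_trans Sy.
have xb : x <= b 0 i.
  have /andP[h1 h2] := Aab z Az i; apply: le_trans h2.
  by move/negP: Sz; rewrite -ltNge => /ltW.
have hS : (box_hull_vol (A `&` S) <= (vol a (up b))%:E)%E.
  apply: box_hull_vol_le => [j|w [Aw Sw] j].
    by have [->|ji] := eqVneq j i; rewrite ?upi ?upj.
  have /andP[h1 h2] := Aab w Aw j.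
  by have [->|ji] := eqVneq j i; rewrite ?upi ?upj ?h1 //= ?h2 // -?(eqP ji);
    have /andP[-> _] := Aab w Aw i.
have hC : (box_hull_vol (A `&` ~` S) <= (vol (up a) b)%:E)%E.
  apply: box_hull_vol_le => [j|w [Aw Sw] j].
    by have [->|ji] := eqVneq j i; rewrite ?upi ?upj.
  have /andP[h1 h2] := Aab w Aw j.
  have [->|ji] := eqVneq j i; last by rewrite upj ?h1.
  have /andP[_ ->] := Aab w Aw i; rewrite upi andbT.
  by move/negP: Sw; rewrite -ltNge => /ltW.
apply: le_trans (leeD hS hC) _; rewrite -EFinD lee_fin /vol.
rewrite (bigD1 i) //= upi [X in _ + X](bigD1 i) //= upi [leRHS](bigD1 i) //=.
rewrite (eq_bigr (fun j => b 0 j - a 0 j)); last by move=> j ji; rewrite upj.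
rewrite [X in _ + _ * X](eq_bigr (fun j => b 0 j - a 0 j)); last by move=> j ji; rewrite upj.
by rewrite -mulrDl [X in X * _]addrC addrA subrK.
Qed.

Lemma measurable_halfspace i (x : R) :
  measurable ([set y : 'rV[R]_n | y 0 i <= x] : set (LebRn R n)).
Proof.
apply: le_caratheodory_measurable => /= X.
apply: le_ereal_inf_tmp => _ [F [mF XF] <-].
pose A k : set 'rV[R]_n := F k.
have XA : X `<=` \bigcup_k A k by [].
set S := [set y : 'rV[R]_n | y 0 i <= x].
have cover (B : set 'rV[R]_n) : (lebesgue_outer (X `&` B) <=
    \sum_(k <oo) box_hull_vol (A k `&` B))%E.
  apply: ereal_inf_lbound; exists (fun k => A k `&` B) => //; split => //.
  by move=> t [/XA[k _ At] Bt]; exists k.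
apply: le_trans (leeD (cover S) (cover (~` S))) _.
rewrite -nneseriesD => [|k _ _|k _ _]; try exact: box_hull_vol_ge0.
apply: lee_nneseries => [k _|k _]; last exact: box_hull_vol_split.
by rewrite adde_ge0 // box_hull_vol_ge0.
Qed.

Lemma measurable_coord i :
  measurable_fun [set: LebRn R n] (fun y : LebRn R n => (y : 'rV[R]_n) 0 i).
Proof.
apply: (measurability _ (RGenOInfty.measurableE R)) => _ [_ [x ->] <-].
rewrite setTI; rewrite (_ : _ @^-1` _ = ~` [set y : 'rV[R]_n | y 0 i <= x]).
  by apply: measurableC; apply: measurable_halfspace.
by apply/seteqP; split => y /=; rewrite in_itv /= andbT ltNge => /negP.
Qed.

Lemma measurable_box a b : measurable (box a b : set (LebRn R n)).
Proof.
rewrite (_ : box a b = \bigcap_(i in [set: 'I_n])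
    (fun y : 'rV[R]_n => y 0 i) @^-1` `[a 0 i, b 0 i]%classic).
  apply: fin_bigcap_measurable => // i _; rewrite -[X in measurable X]setTI.
  exact: (measurable_coord i).
apply/seteqP; split=> y h i; first by move=> _; rewrite /= in_itv /= h.
by have := h i I; rewrite /= in_itv.
Qed.

Lemma measurable_open (U : set 'rV[R]_n) : open U ->
  measurable (U : set (LebRn R n)).
Proof.
move=> oU; pose ctr (q : 'rV[rat]_n) : 'rV[R]_n := map_mx ratr q.
pose e (k : nat) : R := k.+1%:R^-1.
have e0 k : 0 < e k by rewrite invr_gt0 ltr0n.
have -> : U = \bigcup_(qk in [set: 'rV[rat]_n * nat])
    ([set y | ball (ctr qk.1) (e qk.2) y /\ ball (ctr qk.1) (e qk.2) `<=` U]).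
  apply/seteqP; split=> [y Uy|y [qk _ [yb]]]; last exact.
  have /nbhs_ballP[r r0 rU] : nbhs y U by apply: open_nbhs_nbhs.
  have [k kr] : exists k, 2 * e k < r.
    exists (Num.truncn (2 / r)); rewrite /e ltr_pdivrMr ?ltr0n // mulrC.
    by rewrite -ltr_pdivrMr // truncnS_gt.
  have /choice[q qP] (i : 'I_n) : exists q : rat, `|ratr q - y 0 i| < e k.
    have [q] := rat_in_itvoo (ltr_pwDr (e0 k) (lexx (y 0 i))).
    rewrite in_itv /= => /andP[q1 q2]; exists q.
    by rewrite ger0_norm ?subr_ge0 ?(ltW q1) // ltrBlDl.
  have yq : ball (ctr (\row_i q i)) (e k) y.
    by split=> // j i; rewrite (ord1 j) !mxE; apply: qP.
  exists (\row_i q i, k) => //; split=> // z [_ zq]; apply: rU.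
  split=> // j i; have [_ /(_ j i) h1] := yq; have h2 := zq j i.
  rewrite /ball /= in h1 h2 *; apply: le_lt_trans (ler_distD (ctr (\row_i q i) j i) _ _) _.
  by apply: lt_trans kr; rewrite mulr_natl mulr2n ltrD // distrC.
apply: countable_bigcupT_measurable => // -[q k] /=.
have [sub|nsub] := pselect (ball (ctr q) (e k) `<=` U); last first.
  by rewrite (_ : mkset _ = set0) // -subset0 => y [].
rewrite (_ : mkset _ = \bigcap_(i in [set: 'I_n])
    (fun y : 'rV[R]_n => y 0 i) @^-1` (ball (ctr q 0 i) (e k))).
  apply: fin_bigcap_measurable => // i _; rewrite -[X in measurable X]setTI.
  apply: (measurable_coord i) => //; apply: open_measurable.
  exact: ball_open.
apply/seteqP; split=> y.
  by move=> [[_ h] _] i _; apply: h.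
by move=> h; split=> //; split=> // j i; rewrite (ord1 j); apply: h.
Qed.

Lemma measurable_closed (U : set 'rV[R]_n) : closed U ->
  measurable (U : set (LebRn R n)).
Proof.
by move=> cU; rewrite -[U]setCK; apply: measurableC; apply/measurable_open/closed_openC.
Qed.

Lemma within_continuous_measurable (K : set 'rV[R]_n) (x : 'rV[R]_n -> R) :
  closed K -> {within K, continuous x} ->
  measurable_fun (K : set (LebRn R n)) (x : LebRn R n -> R).
Proof.
move=> cK /continuousP cx; apply: (measurability _ (RGenOInfty.measurableE R)).
move=> _ [_ [y ->] <-].
have /open_subspaceP[V oV VK] := cx _ (@rray_open _ _ y).
rewrite [X in measurable X]setIC -VK; apply: measurableI.
  exact: measurable_open.
exact: measurable_closed.
Qed.

Lemma lebRn_box a b : (forall i, a 0 i <= b 0 i) ->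
  (lebRn R n (box a b) <= (vol a b)%:E)%E.
Proof.
move=> ab; apply: le_trans (lebesgue_outer_le_hull _) _.
exact: box_hull_vol_le.
Qed.

Lemma lebRn_sigma_finite : sigma_finite [set: LebRn R n] (lebRn R n).
Proof.
exists (fun k => box (const_mx (- k%:R)) (const_mx k%:R) : set (LebRn R n)).
  apply/seteqP; split=> // y _.
  pose M := \sum_i `|(y : 'rV[R]_n) 0 i|.
  exists (Num.truncn M).+1 => // i; rewrite !mxE -ler_norml.
  apply/ltW/(le_lt_trans _ (truncnS_gt M)).
  by rewrite /M (bigD1 i) //= lerDl sumr_ge0.
move=> k; split; first exact: measurable_box.
apply: le_lt_trans (lebRn_box _) (ltry _) => i.
by rewrite !mxE (@le_trans _ _ 0) ?oppr_le0 ?ler0n.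
Qed.

Lemma bounded_sub_box (A : set 'rV[R]_n) : bounded_set A ->
  exists a b, (forall i, a 0 i <= b 0 i) /\ A `<=` box a b.
Proof.
move=> /(@pinfty_ex_gt0 _ _)[M M0 AM].
exists (const_mx (- M)), (const_mx M); split=> [i|x Ax i]; rewrite !mxE; first lra.
rewrite -ler_norml; have := AM _ Ax; apply: le_trans.
by rewrite [leRHS]/Num.norm/= mx_normrE; apply: (le_trans _ (le_bigmax _ _ (0, i))).
Qed.

Lemma lebRn_bounded (A : set 'rV[R]_n) : bounded_set A -> (lebRn R n A < +oo)%E.
Proof.
move=> /bounded_sub_box[a [b [ab Aab]]].
apply: le_lt_trans (le_lt_trans (lebRn_box ab) (ltry _)).
exact: (le_outer_measure (lebesgue_outerO R n)).
Qed.

End LebesgueMeasurableSets.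

Section OuterRegularity.
Variables (R : realType) (n : nat).

Definition brick (F : set 'rV[R]_n) (v : R) :=
  (F = set0 /\ v = 0) \/
  exists a b : 'rV[R]_n, [/\ forall i, a 0 i <= b 0 i, F = box a b & v = vol a b].

Lemma brick_ge0 F v : brick F v -> 0 <= v.
Proof.
case=> [[_ ->//]|[a [b [ab _ ->]]]].
by apply: prodr_ge0 => i _; rewrite subr_ge0.
Qed.

Lemma brick_cover (A : set 'rV[R]_n) (e : R) : (box_hull_vol A < +oo)%E -> 0 < e ->
  exists F v, [/\ brick F v, A `<=` F & (v%:E <= box_hull_vol A + e%:E)%E].
Proof.
move=> Aoo e0; have [->|A0] := pselect (A = set0).
  by exists set0, 0; split=> //; [left|rewrite box_hull_vol0 add0e lee_fin ltW].
have Afin : box_hull_vol A \is a fin_num.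
  by rewrite ge0_fin_numE // box_hull_vol_ge0.
move: (Afin); rewrite {1}/box_hull_vol asboolF // => Ifin.
have [_ [[a b] /= Aab <-] lt_e] := lb_ereal_inf_adherent e0 Ifin.
exists (box a b), (vol a b); split=> //.
  right; exists a, b; split=> // i.
  have [x Ax] : A !=set0 by apply/set0P/eqP.
  by have /andP[h1 h2] := Aab x Ax i; apply: le_trans h2.
by apply: ltW; apply: lt_le_trans lt_e _; rewrite /box_hull_vol asboolF.
Qed.

Lemma lebesgue_outer_cover (A : set 'rV[R]_n) (e : R) :
  (lebesgue_outer A < +oo)%E -> 0 < e ->
  exists (F : nat -> set 'rV[R]_n) (v : nat -> R),
  [/\ forall k, brick (F k) (v k), A `<=` \bigcup_k F k &
      (\sum_(k <oo) (v k)%:E <= lebesgue_outer A + e%:E)%E].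
Proof.
move=> Aoo e0; have e20 : 0 < e / 2 by rewrite divr_gt0.
have Afin : lebesgue_outer A \is a fin_num.
  by rewrite ge0_fin_numE // (outer_measure_ge0 (lebesgue_outerO R n)).
have [_ [B [_ AB] <-] ltB] := lb_ereal_inf_adherent e20 Afin.
have Bge0 k : (0 <= box_hull_vol (B k))%E by exact: box_hull_vol_ge0.
have Bfin k : (box_hull_vol (B k) < +oo)%E.
  have [Bk|] := eqVneq (box_hull_vol (B k)) +oo%E; last by rewrite ltey.
  have := @nneseries_pinfty _ (fun k => box_hull_vol (B k)) xpredT k (fun i _ => Bge0 i) isT Bk.
  by move=> BE; move: ltB; rewrite BE ltNge leey.
have ek k : 0 < e / 2 / (2 ^ k.+1)%:R by rewrite divr_gt0 // ltr0n expn_gt0.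
have /choice[Fv FvP] k : exists Fv : set 'rV[R]_n * R,
    [/\ brick Fv.1 Fv.2, B k `<=` Fv.1 &
      (Fv.2%:E <= box_hull_vol (B k) + (e / 2 / (2 ^ k.+1)%:R)%:E)%E].
  by have [F [v h]] := brick_cover (Bfin k) (ek k); exists (F, v).
exists (fun k => (Fv k).1), (fun k => (Fv k).2); split.
- by move=> k; have [] := FvP k.
- by move=> x /AB [k _ Bkx]; exists k => //; have [_ h _] := FvP k; apply: h.
apply: (@le_trans _ _ (\sum_(k <oo) (box_hull_vol (B k) + (e / 2 / (2 ^ k.+1)%:R)%:E))%E).
  apply: lee_nneseries => [k *|k *]; last by have [] := FvP k.
  by have [h _ _] := FvP k; rewrite lee_fin (brick_ge0 h).
apply: le_trans (epsilon_trick xpredT Bge0 (ltW e20)) _.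
rewrite [in leRHS](splitr e) EFinD addeA leeD2r //.
exact: ltW.
Qed.

Section Pullback.
Context d (X : measurableType d) (iota : X -> 'rV[R]_n).
Variable nu : {measure set X -> \bar R}.
Hypothesis nu_box : forall a b : 'rV[R]_n, (forall i, a 0 i <= b 0 i) ->
  measurable (iota @^-1` box a b) /\ (nu (iota @^-1` box a b) <= (vol a b)%:E)%E.

Lemma nu_brick F v : brick F v ->
  measurable (iota @^-1` F) /\ (nu (iota @^-1` F) <= v%:E)%E.
Proof.
case=> [[-> ->]|[a [b [ab -> ->]]]]; last exact: nu_box.
by rewrite preimage_set0 measure0; split.
Qed.

Lemma nu_bricks (F : nat -> set 'rV[R]_n) v : (forall k, brick (F k) (v k)) ->
  measurable (iota @^-1` \bigcup_k F k) /\
  (nu (iota @^-1` \bigcup_k F k) <= \sum_(k <oo) (v k)%:E)%E.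
Proof.
move=> Fv; have mF k : measurable (iota @^-1` F k) := (nu_brick (Fv k)).1.
rewrite preimage_bigcup; split; first exact: bigcupT_measurable.
apply: le_trans (measure_sigma_subadditive _ mF _ (@subset_refl _ _)) _.
  exact: bigcupT_measurable.
by apply: lee_nneseries => k *; [exact: measure_ge0|exact: (nu_brick (Fv k)).2].
Qed.

End Pullback.

Lemma lebesgue_outer_regular (A : set 'rV[R]_n) : (lebesgue_outer A < +oo)%E ->
  exists G : set 'rV[R]_n, [/\ A `<=` G,
    measurable (G : set (LebRn R n)), (lebRn R n G <= lebesgue_outer A)%E &
    forall d (X : measurableType d) (iota : X -> 'rV[R]_n)
      (nu : {measure set X -> \bar R}),
      (forall a b : 'rV[R]_n, (forall i, a 0 i <= b 0 i) ->
        measurable (iota @^-1` box a b) /\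
        (nu (iota @^-1` box a b) <= (vol a b)%:E)%E) ->
      measurable (iota @^-1` G) /\ (nu (iota @^-1` G) <= lebesgue_outer A)%E].
Proof.
move=> Aoo.
have inv0 j : 0 < j.+1%:R^-1 :> R by rewrite invr_gt0 ltr0n.
have /choice[Fv FvP] j : exists Fv : (nat -> set 'rV[R]_n) * (nat -> R),
    [/\ forall k, brick (Fv.1 k) (Fv.2 k), A `<=` \bigcup_k Fv.1 k &
     (\sum_(k <oo) (Fv.2 k)%:E <= lebesgue_outer A + (j.+1%:R^-1)%:E)%E].
  by have [F [v h]] := lebesgue_outer_cover Aoo (inv0 j); exists (F, v).
pose G := \bigcap_j \bigcup_k (Fv j).1 k.
have pull d (X : measurableType d) (iota : X -> 'rV[R]_n)
    (nu : {measure set X -> \bar R}) :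
    (forall a b : 'rV[R]_n, (forall i, a 0 i <= b 0 i) ->
      measurable (iota @^-1` box a b) /\
      (nu (iota @^-1` box a b) <= (vol a b)%:E)%E) ->
    measurable (iota @^-1` G) /\ (nu (iota @^-1` G) <= lebesgue_outer A)%E.
  move=> nu_box; have [mU nuU] : (forall j, measurable (iota @^-1` \bigcup_k (Fv j).1 k)) /\
      forall j, (nu (iota @^-1` \bigcup_k (Fv j).1 k) <= \sum_(k <oo) ((Fv j).2 k)%:E)%E.
    by split=> j; have [h _ _] := FvP j; have [] := nu_bricks nu_box h.
  have mG : measurable (iota @^-1` G).
    by rewrite preimage_bigcap; apply: bigcapT_measurable.
  split=> //; apply/lee_addgt0Pr => e e0.
  pose j := Num.truncn e^-1.
  have je : j.+1%:R^-1 <= e.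
    by rewrite invf_ple ?posrE ?ltr0n // ltW // truncnS_gt.
  apply: (@le_trans _ _ (nu (iota @^-1` \bigcup_k (Fv j).1 k))).
    by apply: le_measure; rewrite ?inE // => x Gx; apply: Gx.
  apply: le_trans (nuU j) _; have [_ _ h] := FvP j; apply: le_trans h _.
  by rewrite leeD2l // lee_fin.
have [mG lG] := pull _ (LebRn R n) idfun (lebRn R n)
  (fun a b ab => conj (measurable_box a b) (lebRn_box ab)).
exists G; split=> //.
by move=> x Ax j _; have [_ h _] := FvP j; apply: h.
Qed.

Section PullbackMeasurable.
Context d (X : measurableType d) (iota : X -> 'rV[R]_n).
Variable nu : {measure set X -> \bar R}.
Hypothesis nu_box : forall a b : 'rV[R]_n, (forall i, a 0 i <= b 0 i) ->
  measurable (iota @^-1` box a b) /\ (nu (iota @^-1` box a b) <= (vol a b)%:E)%E.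

Lemma pullback_measurable (Z : set 'rV[R]_n) : measurable (Z : set (LebRn R n)) ->
  (lebRn R n Z < +oo)%E ->
  exists N : set X, [/\ measurable N, nu N = 0%E & measurable (iota @^-1` Z `\` N)].
Proof.
move=> mZ Zoo; have [G [ZG mG lG Gpull]] := lebesgue_outer_regular Zoo.
have Goo : (lebRn R n G < +oo)%E := le_lt_trans lG Zoo.
have GZ0 : lebRn R n (G `\` Z) = 0%E.
  apply/eqP; rewrite eq_le measure_ge0 andbT.
  rewrite measureD // (_ : G `&` Z = Z); last by apply: setIidr.
  rewrite leeBlDr ?add0e //.
  by rewrite ge0_fin_numE // measure_ge0.
have GZoo : (lebesgue_outer (G `\` Z) < +oo)%E by rewrite [lebesgue_outer _]GZ0.
have [G0 [sub _ _ Npull]] := lebesgue_outer_regular GZoo.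
have [mN lN] := Npull _ _ _ _ nu_box; have [mG' _] := Gpull _ _ _ _ nu_box.
exists (iota @^-1` G0); split=> //.
  by apply/eqP; rewrite eq_le measure_ge0 andbT -[leRHS]GZ0.
rewrite (_ : _ `\` _ = iota @^-1` G `\` iota @^-1` G0); first exact: measurableD.
apply/seteqP; split=> x [h1 h2]; split=> //; first exact: ZG.
by apply: contrapT => nZ; apply: h2; apply: sub.
Qed.

Lemma pullback_measurable_fun (D : set 'rV[R]_n) (h : 'rV[R]_n -> R) :
  measurable (D : set (LebRn R n)) -> (lebRn R n D < +oo)%E ->
  measurable_fun (D : set (LebRn R n)) (h : LebRn R n -> R) ->
  exists N : set X, [/\ measurable N, nu N = 0%E,
    measurable (iota @^-1` D `\` N) & measurable_fun (iota @^-1` D `\` N) (h \o iota)].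
Proof.
move=> mD Doo mh.
pose q (k : nat) : R := ratr (odflt 0 (unpickle k)).
pose Z k := D `&` h @^-1` `]q k, +oo[%classic.
have mZ k : measurable (Z k : set (LebRn R n)) by apply: mh.
have Zoo k : (lebRn R n (Z k) < +oo)%E.
  by apply: le_lt_trans Doo; apply: le_measure; rewrite ?inE // => x [].
have /choice[N NP] k := pullback_measurable (mZ k) (Zoo k).
have [N0 [mN0 nuN0 mDN0]] := pullback_measurable mD Doo.
pose NN := N0 `|` \bigcup_k N k.
have mNk k : measurable (N k) by have [] := NP k.
have mU : measurable (\bigcup_k N k) by apply: bigcupT_measurable.
have mNN : measurable NN by apply: measurableU.
have mDN : measurable (iota @^-1` D `\` NN).
  by rewrite -setDDl; apply: measurableD.
exists NN; split=> //.
  apply/eqP; rewrite eq_le measure_ge0 andbT.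
  apply: le_trans (measureU2 _ mN0 mU) _; rewrite [X in (X + _)%E]nuN0 add0e.
  apply: le_trans (measure_sigma_subadditive _ mNk mU (@subset_refl _ _)) _.
  by rewrite eseries0 // => k _ _; have [] := NP k.
apply: (measurability _ (RGenOInfty.measurableE R)) => _ [_ [x ->] <-].
rewrite (_ : _ `&` _ = \bigcup_k
    (if x <= q k then (iota @^-1` Z k `\` N k) `\` NN else set0)).
  apply: bigcupT_measurable => k; case: ifP => // _.
  by apply: measurableD => //; have [] := NP k.
apply/seteqP; split=> [y [[Dy nNy]]|y [k _]].
  rewrite /= in_itv /= andbT => /rat_in_itvoo[r].
  rewrite in_itv /= => /andP[xr rh]; exists (pickle r) => //.
  rewrite /q pickleK /= (ltW xr); split=> //; split.
    by split=> //=; rewrite /q pickleK /= in_itv /= andbT.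
  by move=> Ny; apply: nNy; right; exists (pickle r).
case: ifP => // xq [[[Dy]]] /=; rewrite !in_itv /= !andbT => qh nN nNN.
by split=> //; apply: le_lt_trans qh.
Qed.

End PullbackMeasurable.

End OuterRegularity.

Lemma complete_measurable_fun d (T : measurableType d) (R : realType)
    (m : {measure set T -> \bar R}) d' (U : measurableType d') (D : set T)
    (f g : T -> U) : measure_is_complete m -> measurable_fun D f ->
  (\forall x \ae m, D x -> f x = g x) -> measurable_fun D g.
Proof.
move=> mc mf [B [mB B0 sB]] mD Y mY.
have eqB x : ~ B x -> D x -> f x = g x by move=> nB; apply: contrapT => h; apply/nB/sB.
have -> : D `&` g @^-1` Y = (D `&` f @^-1` Y) `\` B `|` (B `&` (D `&` g @^-1` Y)).
  apply/seteqP; split=> x /=.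
    move=> [Dx gY]; have [Bx|nB] := pselect (B x); first by right.
    by left; split=> //; split=> //; rewrite eqB.
  by move=> [[[Dx fY] nB]|[_ //]]; split=> //; rewrite -eqB.
apply: measurableU; first by apply: measurableD => //; apply: mf.
by apply: mc; exists B; split=> // x [].
Qed.

Lemma measurable_fun_EFin d (T : measurableType d) (R : realType) (D : set T)
    (g : T -> R) : measurable_fun D g -> measurable_fun D (fun x => (g x)%:E).
Proof. by move=> /measurable_EFinP. Qed.

Section FubiniKernel.
Context d (T : measurableType d) (R : realType).
Variable m : {sigma_finite_measure set T -> \bar R}.
Hypothesis m_complete : measure_is_complete m.

Lemma ae_null_sections (N : set (T * T)) : measurable N -> (m \x m)%E N = 0%E ->
  (\forall t \ae m, m (xsection N t) = 0%E) /\
  (\forall s \ae m, m (ysection N s) = 0%E).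
Proof.
move=> mN N0; have mx := measurable_fun_xsection m mN.
have my := measurable_fun_ysection m mN.
have Ny : (\int[m]_s m (ysection N s) = 0)%E.
  have := indic_fubini_tonelli m m mN.
  by rewrite indic_fubini_tonelli_FE // indic_fubini_tonelli_GE // => <-.
split.
  have /(ae_eq_integral_abs m measurableT mx) : (\int[m]_t `|m (xsection N t)| = 0)%E.
    by under eq_integral do rewrite gee0_abs ?measure_ge0 //.
  by apply: filterS => t /(_ I).
have /(ae_eq_integral_abs m measurableT my) : (\int[m]_s `|m (ysection N s)| = 0)%E.
  by under eq_integral do rewrite gee0_abs ?measure_ge0 //.
by apply: filterS => t /(_ I).
Qed.

Variables (A K : set T) (k : T -> T -> R) (h Phi : T -> R) (N : set (T * T)) (c : R).
Hypotheses (mA : measurable A) (mK : measurable K) (AK : A `<=` K).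
Hypothesis A_fin : (m A < +oo)%E.
Hypotheses (mN : measurable N) (N0 : (m \x m)%E N = 0%E).
Hypothesis mk : measurable_fun ((K `*` K) `\` N) (fun z => k z.1 z.2).
Hypothesis mkt : forall t, K t -> measurable_fun K (k t).
Hypotheses (mh : measurable_fun K h) (h0 : forall s, K s -> 0 <= h s).
Hypotheses (mPhi : measurable_fun K Phi) (Phi0 : forall s, K s -> 0 <= Phi s).
Hypothesis kPhi : forall t, K t -> \forall s \ae m, K s -> `|k t s| <= Phi s.
Hypothesis c0 : 0 < c.
Hypothesis Phik : \forall s \ae m, K s ->
  ((c * Phi s)%:E <= \int[m]_(t in A) (k t s)%:E)%E.
Hypothesis Phih : (\int[m]_(s in K) (Phi s * h s)%:E < +oo)%E.

Let E := (A `*` K) `\` N.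
Let H : T * T -> \bar R := (fun z => (k z.1 z.2 * h z.2)%:E) \_ E.

Let mE : measurable E.
Proof. by apply: measurableD => //; apply: measurableX. Qed.

Let mH : measurable_fun setT H.
Proof.
apply: (@measurable_restrictT _ _ _ _ _ _ mE).1; apply: measurable_fun_EFin.
apply: measurable_funM.
  apply: measurable_funS mk; first by apply: measurableD => //; apply: measurableX.
  by move=> z [[z1 z2] nN]; split=> //; split=> //; apply: AK.
apply: (measurable_comp mK _ mh) => [|]; first by move=> _ [z [[_ z2] _] <-].
by apply: measurable_funTS; apply: measurable_snd.
Qed.

Let HE t s : A t -> K s -> ~ N (t, s) -> H (t, s) = (k t s * h s)%:E.
Proof. by move=> At Ks nN; rewrite /H patchT // inE. Qed.

Let HnE t s : ~ (A t /\ K s) -> H (t, s) = 0%E.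
Proof. by move=> nAK; rewrite /H patchC // inE /= => -[]. Qed.

Let HN t s : N (t, s) -> H (t, s) = 0%E.
Proof. by move=> Nts; rewrite /H patchC // inE /= => -[]. Qed.

Let mPhih : measurable_fun setT ((fun s => (Phi s * h s)%:E) \_ K).
Proof.
apply: (@measurable_restrictT _ _ _ _ _ _ mK).1; apply: measurable_fun_EFin.
exact: measurable_funM.
Qed.

Let mH1 t : measurable_fun setT (fun s => H (t, s)).
Proof. exact: (measurableT_comp mH (pair1_measurable t)). Qed.

Let mH2 s : measurable_fun setT (fun t => H (t, s)).
Proof. exact: (measurableT_comp mH (pair2_measurable s)). Qed.

Let C := (\int[m]_(s in K) (Phi s * h s)%:E)%E.

Let C_ge0 : (0 <= C)%E.
Proof. by apply: integral_ge0 => s Ks; rewrite lee_fin mulr_ge0 ?Phi0 ?h0. Qed.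

Let H_bound t : (\int[m]_s `|H (t, s)| <= (cst C \_ A) t)%E.
Proof.
have [At|nAt] := pselect (A t); last first.
  rewrite patchC ?inE // integral0_eq // => s _.
  by rewrite HnE ?abse0 // => -[].
rewrite patchT ?inE // /= /C [leRHS]integral_mkcond.
apply: ae_ge0_le_integral => //.
- exact: measurableT_comp.
- move=> s _; rewrite /patch; case: ifPn; rewrite ?inE // => Ks.
  by rewrite lee_fin mulr_ge0 ?Phi0 ?h0.
- have := kPhi (AK At); apply: filterS => s ks _.
  have [Ks|nKs] := pselect (K s); last by rewrite HnE ?abse0 ?patchC ?inE // => -[].
  rewrite patchT ?inE //.
  have [Nts|nN] := pselect (N (t, s)).
    by rewrite HN // abse0 lee_fin mulr_ge0 ?Phi0 ?h0.
  by rewrite HE // lee_fin normrM (ger0_norm (h0 Ks)) ler_wpM2r ?h0 ?ks.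
Qed.

Let H_integrable : (m \x m)%E.-integrable setT H.
Proof.
apply/integrable12ltyP => //.
apply: (@le_lt_trans _ _ (\int[m]_t (cst C \_ A) t)%E).
  apply: ge0_le_integral => //.
  - by move=> t _; apply: integral_ge0.
  - by apply: (measurable_fun_fubini_tonelli_F (abse \o H)) => //=; apply: measurableT_comp.
  - exact: (@measurable_restrictT _ _ _ _ _ _ mA).1.
rewrite -integral_mkcond integral_cst //.
by rewrite lte_mul_pinfty // ge0_fin_numE.
Qed.

Let Th t := (\int[m]_(s in K) (k t s * h s)%:E)%E.

Let fubini_FE : \forall t \ae m, (\int[m]_s H (t, s) = (Th \_ A) t)%E.
Proof.
have := (ae_null_sections mN N0).1; apply: filterS => t Nt.
have [At|nAt] := pselect (A t); last first.
  rewrite patchC ?inE // integral0_eq // => s _; by rewrite HnE // => -[].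
rewrite patchT ?inE // /Th [RHS]integral_mkcond; apply: ae_eq_integral => //.
  apply: (@measurable_restrictT _ _ _ _ _ _ mK).1; apply: measurable_fun_EFin.
  by apply: measurable_funM => //; apply: mkt; apply: AK.
exists (xsection N t); split => //; first exact: measurable_xsection.
move=> s /= hs; apply: contrapT => nN; apply: hs => _.
have [Ks|nKs] := pselect (K s); last by rewrite HnE ?patchC ?inE // => -[].
by rewrite patchT ?inE // HE // => Nts; apply: nN; rewrite /xsection /= inE.
Qed.

Let fubini_GE : \forall s \ae m,
  (((fun s => (c * (Phi s * h s))%:E) \_ K) s <= \int[m]_t H (t, s))%E.
Proof.
have := (ae_null_sections mN N0).2; have := ae_integrable2 H_integrable.
have := Phik; apply: filterS3 => s ks iH Ns.
have [Ks|nKs] := pselect (K s); last first.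
  rewrite patchC ?inE // integral0_eq // => t _; by rewrite HnE // => -[].
rewrite patchT ?inE //.
pose B := A `\` ysection N s.
have mB : measurable B by apply: measurableD => //; apply: measurable_ysection.
have HB : (fun t => H (t, s)) = (fun t => (k t s * h s)%:E) \_ B.
  apply/funext => t; have [[At nN]|nB] := pselect (B t).
    by rewrite patchT ?inE // HE // => Nts; apply: nN; rewrite /ysection /= inE.
  rewrite patchC ?inE //; have [At|nAt] := pselect (A t); last by rewrite HnE // => -[].
  have [Nts|nN] := pselect (N (t, s)); first by rewrite HN.
  by exfalso; apply: nB; split=> //; rewrite /ysection /= inE.
have -> : (\int[m]_t H (t, s) = \int[m]_(t in B) (k t s * h s)%:E)%E.
  by rewrite HB -integral_mkcond.
have [hs0|hs0] := eqVneq (h s) 0.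
  rewrite hs0 !mulr0 integral0_eq // => t _; by rewrite mulr0.
have hspos : 0 < h s by rewrite lt0r hs0 h0.
have ikh : m.-integrable B (fun t => (k t s * h s)%:E).
  by apply/integrable_mkcond => //; rewrite -HB.
have ik : m.-integrable B (fun t => (k t s)%:E).
  have := integrableZl mB (h s)^-1 ikh; apply: eq_integrable => // t _.
  by rewrite -EFinM mulrC mulfK.
have -> : (\int[m]_(t in B) (k t s * h s)%:E = (h s)%:E * \int[m]_(t in B) (k t s)%:E)%E.
  by rewrite -integralZl //; apply: eq_integral => t _; rewrite mulrC.
have -> : (\int[m]_(t in B) (k t s)%:E = \int[m]_(t in A) (k t s)%:E)%E.
  rewrite [LHS]integral_mkcond [RHS]integral_mkcond.
  have mkB : measurable_fun setT ((fun t => (k t s)%:E) \_ B).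
    by apply: (@measurable_restrictT _ _ _ _ _ _ mB).1; apply: measurable_int ik.
  have eqAB : \forall t \ae m, setT t ->
      ((fun t => (k t s)%:E) \_ B) t = ((fun t => (k t s)%:E) \_ A) t.
    exists (ysection N s); split => //; first exact: measurable_ysection.
    move=> t /= ht; apply: contrapT => nN; apply: ht => _.
    have [Bt|nB] := pselect (B t); first by rewrite !patchT ?inE //; apply: Bt.1.
    have [At|nAt] := pselect (A t); last by rewrite !patchC ?inE.
    by exfalso; apply: nB; split.
  by apply: ae_eq_integral => //; apply: complete_measurable_fun eqAB.
have -> : c * (Phi s * h s) = h s * (c * Phi s) by ring.
by rewrite EFinM; apply: lee_wpmul2l; [rewrite lee_fin ltW|exact: ks].
Qed.

Theorem fubini_kernel_le : measurable_fun A Th /\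
  (\int[m]_(s in K) (c * (Phi s * h s))%:E <= \int[m]_(t in A) Th t)%E.
Proof.
have mF := measurable_fubini_F H_integrable.
have mG := measurable_fubini_G H_integrable.
have mTh : measurable_fun setT (Th \_ A).
  apply: (complete_measurable_fun m_complete mF).
  by move: fubini_FE; apply: filterS => t ht _.
split; first exact: (@measurable_restrictT _ _ _ _ _ _ mA).2.
have -> : (\int[m]_(t in A) Th t = \int[m]_t \int[m]_s H (t, s))%E.
  rewrite integral_mkcond; apply: ae_eq_integral => //.
  by move: fubini_FE; apply: filterS => t ht _.
rewrite (Fubini H_integrable) [leLHS]integral_mkcond.
have cPhih_ge0 s : (0 <= ((fun s => (c * (Phi s * h s))%:E) \_ K) s)%E.
  rewrite /patch; case: ifPn; rewrite ?inE // => Ks.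
  by rewrite lee_fin !mulr_ge0 ?Phi0 ?h0 // ltW.
have -> : (\int[m]_s \int[m]_t H (t, s) = \int[m]_s `|\int[m]_t H (t, s)|)%E.
  apply: ae_eq_integral => //; first exact: measurableT_comp.
  move: fubini_GE; apply: filterS => s hs _.
  by rewrite gee0_abs //; apply: le_trans hs.
apply: ae_ge0_le_integral => //.
- apply: (@measurable_restrictT _ _ _ _ _ _ mK).1; apply: measurable_fun_EFin.
  by apply: measurable_funM => //; apply: measurable_funM.
- exact: measurableT_comp.
- move: fubini_GE; apply: filterS => s hs _.
  by rewrite gee0_abs //; apply: le_trans hs.
Qed.

End FubiniKernel.

(* [lebRn] is bundled as a measure only; this alias carries its
   sigma-finiteness, as needed for product measures. *)
Definition lebRn_sf (R : realType) n : set (LebRn R n) -> \bar R := lebRn R n.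
HB.instance Definition _ (R : realType) n :=
  isMeasure.Build _ _ _ (@lebRn_sf R n) (measure0 (lebRn R n))
    (measure_ge0 (lebRn R n)) (@measure_semi_sigma_additive _ _ _ (lebRn R n)).
HB.instance Definition _ (R : realType) n :=
  Measure_isSigmaFinite.Build _ _ _ (@lebRn_sf R n) (@lebRn_sigma_finite R n).

Lemma lebRn_complete (R : realType) n : measure_is_complete (lebRn R n).
Proof. exact: measure_is_complete_caratheodory. Qed.

Section ProductOfLebesgue.
Variables (R : realType) (n : nat).

Definition pair_rV (z : LebRn R n * LebRn R n) : 'rV[R]_(n + n) :=
  row_mx (z.1 : 'rV[R]_n) (z.2 : 'rV[R]_n).

Lemma pair_rV_box (a b : 'rV[R]_(n + n)) : (forall i, a 0 i <= b 0 i) ->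
  measurable (pair_rV @^-1` box a b) /\
  ((@lebRn_sf R n \x @lebRn_sf R n) (pair_rV @^-1` box a b) <= (vol a b)%:E)%E.
Proof.
move=> ab.
have -> : pair_rV @^-1` box a b =
    box (lsubmx a) (lsubmx b) `*` box (rsubmx a) (rsubmx b).
  apply/seteqP; split=> -[x y] /=.
    move=> h; split=> i; first by have := h (lshift n i); rewrite row_mxEl !mxE.
    by have := h (rshift n i); rewrite row_mxEr !mxE.
  move=> [hx hy] i; case: (split_ordP i) => j ->.
    by have := hx j; rewrite row_mxEl !mxE.
  by have := hy j; rewrite row_mxEr !mxE.
have m1 := measurable_box (lsubmx a) (lsubmx b).
have m2 := measurable_box (rsubmx a) (rsubmx b).
split; first exact: measurableX.
rewrite product_measure1E // /vol big_split_ord /= EFinM.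
have lab i : lsubmx a 0 i <= lsubmx b 0 i by rewrite !mxE.
have rab i : rsubmx a 0 i <= rsubmx b 0 i by rewrite !mxE.
apply: lee_pmul; rewrite ?measure_ge0 //.
  apply: le_trans (lebRn_box lab) _; rewrite lee_fin /vol.
  rewrite (eq_bigr (fun i => b 0 (lshift n i) - a 0 (lshift n i))) // => i _.
  by rewrite !mxE.
apply: le_trans (lebRn_box rab) _; rewrite lee_fin /vol.
rewrite (eq_bigr (fun i => b 0 (rshift n i) - a 0 (rshift n i))) // => i _.
by rewrite !mxE.
Qed.

Lemma lsubmx_continuous : continuous (lsubmx : 'rV[R]_(n + n) -> 'rV[R]_n).
Proof.
move=> z U /nbhs_ballP[e e0 eU]; apply/nbhs_ballP; exists e => // w [_ zw].
by apply: eU; split=> // i j; rewrite !mxE; apply: zw.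
Qed.

Lemma rsubmx_continuous : continuous (rsubmx : 'rV[R]_(n + n) -> 'rV[R]_n).
Proof.
move=> z U /nbhs_ballP[e e0 eU]; apply/nbhs_ballP; exists e => // w [_ zw].
by apply: eU; split=> // i j; rewrite !mxE; apply: zw.
Qed.

Lemma lebRn_kernel_le (A K : set 'rV[R]_n) (k : 'rV[R]_n -> 'rV[R]_n -> R)
    (h Phi : 'rV[R]_n -> R) (c : R) :
  closed K -> bounded_set K -> A `<=` K ->
  measurable (A : set (LebRn R n)) ->
  measurable_fun
    ([set z | K (lsubmx z) /\ K (rsubmx z)] : set (LebRn R (n + n)))
    (fun z : 'rV[R]_(n + n) => k (lsubmx z) (rsubmx z)) ->
  (forall t, K t -> measurable_fun (K : set (LebRn R n)) (k t)) ->
  measurable_fun (K : set (LebRn R n)) h -> (forall s, K s -> 0 <= h s) ->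
  measurable_fun (K : set (LebRn R n)) Phi -> (forall s, K s -> 0 <= Phi s) ->
  (forall t, K t -> \forall s \ae lebRn R n, K s -> `|k t s| <= Phi s) ->
  0 < c ->
  (\forall s \ae lebRn R n, K s ->
     ((c * Phi s)%:E <= \int[lebRn R n]_(t in A) (k t s)%:E)%E) ->
  (\int[lebRn R n]_(s in K) (Phi s * h s)%:E < +oo)%E ->
  measurable_fun (A : set (LebRn R n))
    (fun t : LebRn R n => \int[lebRn R n]_(s in K) (k t s * h s)%:E)%E /\
  (\int[lebRn R n]_(s in K) (c * (Phi s * h s))%:E <=
   \int[lebRn R n]_(t in A) \int[lebRn R n]_(s in K) (k t s * h s)%:E)%E.
Proof.
move=> cK bK AK mA mk mkt mh h0 mPhi Phi0 kPhi c0 Phik Phih.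
have mK : measurable (K : set (LebRn R n)) := measurable_closed cK.
set D : set 'rV[R]_(n + n) := [set z | _] in mk.
have cD : closed D.
  apply: (@closedI _ (lsubmx @^-1` K) (rsubmx @^-1` K)).
    by apply: (continuous_closedP _).1 cK; apply: lsubmx_continuous.
  by apply: (continuous_closedP _).1 cK; apply: rsubmx_continuous.
have mD : measurable (D : set (LebRn R (n + n))) := measurable_closed cD.
have Doo : (lebRn R (n + n) D < +oo)%E.
  have [a [b [ab Kab]]] := bounded_sub_box bK.
  have ab2 i : (row_mx a a : 'rV[R]_(n + n)) 0 i <= (row_mx b b : 'rV[R]_(n + n)) 0 i.
    by case: (split_ordP i) => j ->; rewrite ?row_mxEl ?row_mxEr.
  apply: le_lt_trans (le_lt_trans (lebRn_box ab2) (ltry _)).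
  apply: (le_outer_measure (lebesgue_outerO R (n + n))) => z [z1 z2] i.
  case: (split_ordP i) => j ->; rewrite ?row_mxEl ?row_mxEr.
    by have := Kab _ z1 j; rewrite !mxE.
  by have := Kab _ z2 j; rewrite !mxE.
have [N [mN N0 mDN mkN]] := pullback_measurable_fun pair_rV_box mD Doo mk.
have DE : pair_rV @^-1` D = (K : set (LebRn R n)) `*` (K : set (LebRn R n)).
  by apply/seteqP; split=> -[x y] /=; rewrite /D /= row_mxKl row_mxKr.
have kE : (fun z : 'rV[R]_(n + n) => k (lsubmx z) (rsubmx z)) \o pair_rV =
    fun z : LebRn R n * LebRn R n => k z.1 z.2.
  by apply/funext => -[x y] /=; rewrite row_mxKl row_mxKr.
rewrite DE kE in mkN.
have Aoo : (@lebRn_sf R n A < +oo)%E.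
  apply: le_lt_trans (lebRn_bounded bK).
  exact: (le_outer_measure (lebesgue_outerO R n)).
exact: (@fubini_kernel_le _ (LebRn R n) R (@lebRn_sf R n) (@lebRn_complete R n)
  A K k h Phi N c mA mK AK Aoo mN N0 mkN mkt mh h0 mPhi Phi0 kPhi c0 Phik Phih).
Qed.

End ProductOfLebesgue.

(** * The Hammerstein operator *)

Lemma continuous_normr_powR (R : realType) (p : R) : 0 < p ->
  continuous (fun u : R => `|u| `^ p).
Proof.
move=> p0 u; have [->|u0] := eqVneq u 0.
  apply/cvgrPdist_lt => e e0; rewrite normr0 powR0 ?gt_eqF //.
  apply/nbhs_ballP; exists (e `^ p^-1) => /=; first exact: powR_gt0.
  move=> v; rewrite /ball /= !sub0r !normrN => ve.
  rewrite ger0_norm ?powR_ge0 // -[X in _ < X]powRr1 ?ltW // -(mulVf (lt0r_neq0 p0)).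
  by rewrite powRrM gt0_ltr_powR // ?nnegrE ?powR_ge0.
apply: (@continuous_comp _ _ _ (@Num.norm _ R) (fun a => a `^ p)).
  exact: norm_continuous.
apply: differentiable_continuous; apply/derivable1_diffP.
by apply: derivable_powR; rewrite in_itv /= andbT normr_gt0.
Qed.

Lemma cvg_powR (R : realType) (q l : R) (u : nat -> R) : 0 < q ->
  (forall j, 0 <= u j) -> 0 <= l -> u j @[j --> \oo] --> l ->
  u j `^ q @[j --> \oo] --> l `^ q.
Proof.
move=> q0 u0 l0 ul.
have -> : (fun j => u j `^ q) = fun j => `|u j| `^ q.
  by apply/funext => j; rewrite ger0_norm.
have -> : l `^ q = `|l| `^ q by rewrite ger0_norm.
exact: (continuous_cvg _ (@continuous_normr_powR R q q0 l) ul).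
Qed.

Lemma young_powR1 (R : realType) (a p : R) : 0 <= a -> 1 <= p ->
  a <= a `^ p / p + (1 - p^-1).
Proof.
move=> a0; rewrite le_eqVlt => /predU1P[<-|p1].
  by rewrite powRr1 // invr1 mulr1 subrr addr0.
have p0 : 0 < p by apply: lt_trans p1.
have q0 : 0 < 1 - p^-1 by rewrite subr_gt0 invf_lt1.
have := @conjugate_powR _ a 1 p (1 - p^-1)^-1 a0 ler01 p0.
by rewrite invr_gt0 q0 invrK addrC subrK powR1 mulr1 mul1r => /(_ isT erefl).
Qed.

Lemma convex_combination (R : realType) (X : Type) (D : set (X -> R)) :
  (forall (a : R) (x y : X -> R), 0 <= a <= 1 -> D x -> D y ->
    D (fun t => a * x t + (1 - a) * y t)) ->
  forall d (l : 'I_d -> R) (y : 'I_d -> X -> R),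
  (forall i, 0 <= l i) -> \sum_i l i = 1 -> (forall i, D (y i)) ->
  D (fun t => \sum_i l i * y i t).
Proof.
move=> D2; elim=> [|d IH] l y l0 l1 yD.
  by move: l1; rewrite big_ord0 => /esym/eqP; rewrite oner_eq0.
have l1' : \sum_(i < d) l (lift ord0 i) = 1 - l ord0.
  by rewrite -l1 big_ord_recl addrC addKr.
have le1 : l ord0 <= 1.
  by rewrite -subr_ge0 -l1' sumr_ge0.
have [l01|l01] := eqVneq (l ord0) 1.
  rewrite (_ : (fun t => _) = y ord0) //; apply/funext => t.
  rewrite big_ord_recl l01 mul1r big1 ?addr0 // => i _.
  suff -> : l (lift ord0 i) = 0 by rewrite mul0r.
  by apply: (psumr_eq0P _ (etrans l1' _)) => //; rewrite l01 subrr.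
have nz : 1 - l ord0 != 0 by rewrite subr_eq0 eq_sym.
have pos : 0 < 1 - l ord0 by rewrite lt0r nz subr_ge0.
have := D2 (l ord0) (y ord0)
  (fun t => \sum_i (l (lift ord0 i) / (1 - l ord0)) * y (lift ord0 i) t).
rewrite l0 le1 => /(_ isT (yD _)) h.
rewrite (_ : (fun t => _) = fun t => l ord0 * y ord0 t + (1 - l ord0) *
    \sum_i (l (lift ord0 i) / (1 - l ord0)) * y (lift ord0 i) t); last first.
  apply/funext => t; rewrite big_ord_recl mulr_sumr; congr (_ + _).
  by apply: eq_bigr => i _; rewrite mulrA mulrCA divff // mulr1.
apply: h; apply: IH => // [i|]; first by rewrite divr_ge0 // ltW.
by rewrite -mulr_suml l1' divff.
Qed.

Lemma convex_normr_powR (R : realType) (p a x y : R) : 1 <= p -> 0 <= a <= 1 ->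
  `|a * x + (1 - a) * y| `^ p <= a * `|x| `^ p + (1 - a) * `|y| `^ p.
Proof.
move=> p1 /andP[a0 a1].
have i01 : Itv.spec (@Itv.num_sem R) (Itv.Real `[0%Z, 1%Z]) a.
  by rewrite /Itv.spec /Itv.num_sem /= num_real /= in_itv /= a0 a1.
pose t : {i01 R} := Itv.mk i01.
have := @convex_powR R p p1 t `|x| `|y|; rewrite !inE /= !in_itv /= !normr_ge0.
move=> /(_ isT isT); rewrite !convRE /= => h.
apply: le_trans h; apply: ge0_ler_powR; rewrite ?nnegrE ?addr_ge0 ?mulr_ge0 ?subr_ge0 //.
  by apply: le_trans p1.
have a1' : 0 <= 1 - a by rewrite subr_ge0.
by rewrite (le_trans (ler_normD _ _)) // !normrM (ger0_norm a0) (ger0_norm a1').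
Qed.

Section FiniteMeasureSet.
Context d (T : measurableType d) (R : realType) (m : {measure set T -> \bar R}).
Variable A : set T.
Hypotheses (mA : measurable A) (A_fin : (m A < +oo)%E).

Lemma bounded_by_integrable (u : T -> R) (B : R) : measurable_fun A u ->
  (forall t, A t -> `|u t| <= B) -> m.-integrable A (EFin \o u).
Proof.
move=> mu uB; apply: measurable_bounded_integrable => //.
exists B; split; rewrite ?num_real // => M BM t At /=.
exact: le_trans (uB t At) (ltW BM).
Qed.

Lemma measurable_fun_cvg_real (D : set T) (u_ : nat -> T -> R) (u : T -> R) :
  (forall n, measurable_fun D (u_ n)) ->
  (forall t, D t -> u_ n t @[n --> \oo] --> u t) -> measurable_fun D u.
Proof.
move=> mu cu; apply/measurable_EFinP.
apply: (emeasurable_fun_cvg (fun n t => (u_ n t)%:E)).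
  by move=> n; apply/measurable_EFinP.
by move=> t Dt; apply: cvg_EFin; [apply: nearW|apply: cu].
Qed.

Lemma bounded_convergence (u_ : nat -> T -> R) (u : T -> R) (B : R) :
  (forall n, measurable_fun A (u_ n)) ->
  (forall n t, A t -> `|u_ n t| <= B) ->
  (forall t, A t -> u_ n t @[n --> \oo] --> u t) ->
  Rintegral m A (u_ n) @[n --> \oo] --> Rintegral m A u.
Proof.
move=> mu uB cu; have mu' := measurable_fun_cvg_real mu cu.
have [] := @dominated_convergence _ T R m A mA (fun n t => (u_ n t)%:E)
  (fun t => (u t)%:E) (cst B%:E).
- by move=> n; apply: measurable_fun_EFin.
- exact: measurable_fun_EFin.
- apply: aeW => t At; apply: cvg_EFin; [exact: nearW|exact: cu].
- by apply: (@bounded_by_integrable (cst B) `|B|) => // t _; rewrite /cst.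
- by apply: aeW => t n At; rewrite lee_fin; apply: uB.
move=> iu _ cvg; rewrite /Rintegral.
apply: fine_cvg; rewrite fineK; first exact: cvg.
exact: (integrable_fin_num mA iu).
Qed.

Lemma le_integral_of_powR (u : T -> R) (B v p : R) : 1 <= p -> 0 < v ->
  measurable_fun A u -> (forall t, A t -> 0 <= u t <= B) ->
  Rintegral m A (fun t => u t `^ p) <= v `^ p * fine (m A) ->
  Rintegral m A u <= v * fine (m A).
Proof.
move=> p1 v0 mu uB le_J; have p0 : 0 < p by apply: lt_le_trans p1.
have vp : 0 < v `^ p by apply: powR_gt0.
have iu : m.-integrable A (EFin \o u).
  apply: (@bounded_by_integrable _ B) => // t At.
  by have /andP[u0 ub] := uB t At; rewrite ger0_norm.
have iup : m.-integrable A (EFin \o (fun t => u t `^ p)).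
  apply: (@bounded_by_integrable _ (B `^ p)).
    exact: (measurableT_comp (@measurable_powR R p) mu).
  move=> t At; have /andP[u0 ub] := uB t At.
  rewrite ger0_norm ?powR_ge0 // ge0_ler_powR ?nnegrE ?(ltW p0) //.
  exact: le_trans ub.
pose w t := (v / (p * v `^ p)) * u t `^ p + v * (1 - p^-1).
have wE : Rintegral m A w = (v / (p * v `^ p)) * Rintegral m A (fun t => u t `^ p)
    + v * (1 - p^-1) * fine (m A).
  have ic : m.-integrable A (EFin \o cst (v * (1 - p^-1))).
    by apply: (@bounded_by_integrable _ `|v * (1 - p^-1)|).
  rewrite -RintegralZl //.
  have -> : v * (1 - p^-1) * fine (m A) = Rintegral m A (cst (v * (1 - p^-1))).
    by rewrite Rintegral_cst.
  rewrite -RintegralD //.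
  by have := integrableZl mA (v / (p * v `^ p)) iup.
have iw : m.-integrable A (EFin \o w).
  have ic : m.-integrable A (EFin \o cst (v * (1 - p^-1))).
    by apply: (@bounded_by_integrable _ `|v * (1 - p^-1)|).
  by have := integrableD mA (integrableZl mA (v / (p * v `^ p)) iup) ic.
apply: (@le_trans _ _ (Rintegral m A w)).
  apply: le_Rintegral => // t At; have /andP[u0 _] := uB t At.
  have vV : v^-1 `^ p = (v `^ p)^-1.
    apply: (mulfI (lt0r_neq0 vp)); rewrite -powRM ?invr_ge0 ?(ltW v0) //.
    by rewrite !divff ?lt0r_neq0 // powR1.
  have := young_powR1 (divr_ge0 u0 (ltW v0)) p1.
  rewrite powRM ?invr_ge0 ?(ltW v0) // vV ler_pdivrMr // => /le_trans; apply.
  rewrite /w mulrDl [X in _ + X]mulrC lerD2r invfM le_eqVlt; apply/orP; left.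
  by apply/eqP; ring.
rewrite wE.
have : v / (p * v `^ p) * Rintegral m A (fun t => u t `^ p) <= v / p * fine (m A).
  rewrite (_ : v / p * fine (m A) = v / (p * v `^ p) * (v `^ p * fine (m A))); last first.
    by field; rewrite !gt_eqF.
  by rewrite ler_pM2l // divr_gt0 // mulr_gt0.
by move=> h; rewrite -subr_ge0 in h *; lra.
Qed.

End FiniteMeasureSet.

Lemma caratheodory_comp_measurable d (T : measurableType d) (R : realType)
    (m : {measure set T -> \bar R}) (D : set T) (f : T -> R -> R) (x : T -> R) (r : R) :
  measure_is_complete m -> 0 < r -> measurable_fun D x ->
  (forall t, D t -> -r <= x t <= r) ->
  (forall u, -r <= u <= r -> measurable_fun D (f^~ u)) ->
  (\forall t \ae m, D t -> {within `[-r, r], continuous (f t)}) ->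
  measurable_fun D (fun t => f t (x t)).
Proof.
move=> mc r0 mx xr mf cf.
pose h (N : nat) : R := 2 * r / N.+1%:R.
have h0 N : 0 < h N by rewrite divr_gt0 ?ltr0n // mulr_gt0.
pose u N j : R := - r + j%:R * h N.
pose j N t := Num.truncn ((x t + r) / h N).
pose xN N t := u N (j N t).
have jP N t : D t -> u N (j N t) <= x t < u N (j N t) + h N.
  move=> Dt; have /andP[x1 x2] := xr t Dt.
  have a0 : 0 <= (x t + r) / h N by rewrite divr_ge0 ?(ltW (h0 N)) //; lra.
  have := truncn_itv a0; rewrite -/(j N t) ler_pdivlMr // ltr_pdivrMr // => /andP[h1 h2].
  by rewrite -natr1 mulrDl mul1r in h2; rewrite /u; apply/andP; split; lra.
have uge N k : -r <= u N k by rewrite /u lerDl mulr_ge0 // ltW.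
have mfN N : measurable_fun D (fun t => f t (xN N t)).
  move=> mD Y mY.
  rewrite (_ : _ `&` _ = \bigcup_k (if u N k <= r then
      (D `&` x @^-1` `[u N k, u N k + h N[%classic) `&` (D `&` (f^~ (u N k)) @^-1` Y)
      else set0)).
    apply: bigcupT_measurable => k; case: ifPn => // ur.
    by apply: measurableI; [apply: mx|apply: mf => //; rewrite uge].
  apply/seteqP; split=> t.
    move=> [Dt Yt]; exists (j N t) => //; have /andP[j1 j2] := jP N t Dt.
    have /andP[_ xt] := xr t Dt.
    by rewrite (le_trans j1 xt); split; split=> //=; rewrite in_itv /= j1 j2.
  move=> [k _]; case: ifPn => // _ [[Dt /=]]; rewrite in_itv /= => /andP[k1 k2] [_ Yt].
  split=> //; rewrite /xN; suff -> : j N t = k by [].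
  apply: truncn_def; rewrite ler_pdivlMr // ltr_pdivrMr // -natr1 mulrDl mul1r.
  by rewrite /u in k1 k2; apply/andP; split; lra.
apply/measurable_EFinP.
have mlim := measurable_fun_limn_esup (f := fun N t => (f t (xN N t))%:E)
  (fun N => measurable_fun_EFin (mfN N)).
apply: (complete_measurable_fun mc mlim).
move: cf; apply: filterS => t ct Dt.
have xtr := xr t Dt; have xti : `[-r, r]%classic (x t) by rewrite /= in_itv.
have cvg : (f t (xN N t))%:E @[N --> \oo] --> (f t (x t))%:E.
  apply: cvg_EFin; first exact: nearW.
  apply/cvgrPdist_lt => e e0.
  have [q q0 hq] := within_continuous_dist (ct Dt) xti e0.
  exists (Num.truncn (2 * r / q)) => // N /= qN; apply: hq.
    have /andP[j1 j2] := jP N t Dt; have /andP[_ xt] := xtr.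
    by rewrite /= in_itv /= uge (le_trans j1 xt).
  have /andP[j1 j2] := jP N t Dt.
  have hN : h N < q.
    rewrite /h ltr_pdivrMr ?ltr0n // [ltRHS]mulrC -ltr_pdivrMr //.
    by rewrite (lt_le_trans (truncnS_gt _)) // ler_nat ltnS.
  by rewrite /ball /= ger0_norm ?subr_ge0 // /xN; lra.
rewrite is_cvg_limn_esupE; first exact: (cvg_lim _ cvg).
by apply/cvg_ex; exists (f t (x t))%:E.
Qed.

Section AlmostEverywhere.
Context d (T : measurableType d) (R : realType) (m : {measure set T -> \bar R}).
Variable D : set T.
Hypothesis mD : measurable D.

Lemma ae_le_integrable (u w : T -> R) : measurable_fun D u ->
  m.-integrable D (EFin \o w) -> (\forall t \ae m, D t -> `|u t| <= w t) ->
  m.-integrable D (EFin \o u).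
Proof.
move=> mu iw uw; apply/integrableP; split; first exact: measurable_fun_EFin.
have [mw woo] := integrableP _ _ _ iw; apply: le_lt_trans woo.
apply: ae_ge0_le_integral => //.
- by apply: measurableT_comp => //; apply: measurable_fun_EFin.
- by apply: measurableT_comp.
- move: uw; apply: filterS => t uw Dt; rewrite /= lee_fin.
  exact: le_trans (uw Dt) (ler_norm _).
Qed.

Lemma ae_le_Rintegral (u w : T -> R) : m.-integrable D (EFin \o u) ->
  m.-integrable D (EFin \o w) -> (\forall t \ae m, D t -> u t <= w t) ->
  Rintegral m D u <= Rintegral m D w.
Proof.
move=> iu iw uw; rewrite -subr_ge0 -RintegralB //.
have iwu : m.-integrable D (EFin \o (fun t => w t - u t)) by have := integrableB mD iw iu.
rewrite /Rintegral (_ : (\int[m]_(t in D) (w t - u t)%:E)%E =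
    (\int[m]_(t in D) `|(w t - u t)%:E|)%E).
  by apply: fine_ge0; apply: integral_ge0.
have mwu := measurable_int _ iwu.
apply: ae_eq_integral => //; first exact: measurableT_comp.
by move: uw; apply: filterS => t uw Dt; rewrite gee0_abs // lee_fin subr_ge0 uw.
Qed.

Lemma ae_normr_le_Rintegral (u w : T -> R) : measurable_fun D u ->
  m.-integrable D (EFin \o w) -> (\forall t \ae m, D t -> `|u t| <= w t) ->
  `|Rintegral m D u| <= Rintegral m D w.
Proof.
move=> mu iw uw; have iu := ae_le_integrable mu iw uw.
apply: le_trans (le_normr_Rintegral mD iu) _.
by apply: ae_le_Rintegral => //; have := integrable_abse iu.
Qed.

End AlmostEverywhere.

Section Hammerstein.
Variables (R : realType) (n : nat) (K A : set 'rV[R]_n).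
Variables (r theta eta1 eta2 m c p : R).
Variables (f : 'rV[R]_n -> R -> R) (k : 'rV[R]_n -> 'rV[R]_n -> R).
Variables (g Phi : 'rV[R]_n -> R).
Local Notation mu := (lebRn R n).
Hypotheses (K_closed : closed K) (K_bounded : bounded_set K) (r0 : 0 < r).
Hypothesis AK : A `<=` K.
Hypothesis mA : measurable (A : set (LebRn R n)).
Hypothesis A_pos : (0 < mu A)%E.
Hypotheses (theta01 : 0 < theta < 1) (eta1_gt0 : 0 < eta1) (eta2_gt0 : 0 < eta2).
Hypotheses (m0 : 0 < m) (c0 : 0 < c) (p1 : 1 <= p).
Hypothesis f_ge0 : forall t u, K t -> -r <= u <= r -> 0 <= f t u.
Hypothesis mf : forall u, -r <= u <= r ->
  measurable_fun (K : set (LebRn R n)) (fun t => f t u).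
Hypothesis f_cont : \forall t \ae mu, K t -> {within `[-r, r], continuous (f t)}.
Hypothesis mg : measurable_fun (K : set (LebRn R n)) g.
Hypothesis g_ge0 : forall t, K t -> 0 <= g t.
Hypothesis fg : \forall t \ae mu, K t -> forall u, -r <= u <= r -> f t u <= g t.
Hypothesis f_eta1 : \forall t \ae mu, A t -> forall u,
  theta * m * fine (mu A) `^ (- p^-1) <= `|u| <= r -> eta1 <= f t u.
Hypothesis mk : measurable_fun
  ([set z | K (lsubmx z) /\ K (rsubmx z)] : set (LebRn R (n + n)))
  (fun z : 'rV[R]_(n + n) => k (lsubmx z) (rsubmx z)).
Hypothesis mkt : forall t, K t -> measurable_fun (K : set (LebRn R n)) (k t).
Hypothesis k_cont : forall tau, K tau ->
  (fun t => (\int[mu]_(s in K) (`|k t s - k tau s| * g s)%:E)%E)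
    @ within K (nbhs tau) --> 0%E.
Hypothesis mPhi : measurable_fun (K : set (LebRn R n)) Phi.
Hypothesis Phi_ge0 : forall s, K s -> 0 <= Phi s.
Hypothesis Phi_eta2 : \forall t \ae mu, A t -> eta2 <= Phi t.
Hypothesis kPhi : forall t, K t -> \forall s \ae mu, K s -> `|k t s| <= Phi s.
Hypothesis Phik : \forall s \ae mu, K s ->
  ((c * Phi s)%:E <= \int[mu]_(t in A) (k t s)%:E)%E.
Hypothesis Phig : (\int[mu]_(s in K) (Phi s * g s)%:E < +oo)%E.
Hypothesis m_le : m <= r * c * fine (mu A) `^ (- (1 - p^-1)).

Let mK : measurable (K : set (LebRn R n)) := measurable_closed K_closed.

Let K_fin : (mu K < +oo)%E := lebRn_bounded K_bounded.

Let A_fin : (mu A < +oo)%E.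
Proof.
by apply: le_lt_trans K_fin; apply: (le_outer_measure (lebesgue_outerO R n)).
Qed.

Let muA := fine (mu A).

Let muA_gt0 : 0 < muA.
Proof. by rewrite /muA fine_gt0 // A_pos A_fin. Qed.

Let muAE : mu A = muA%:E.
Proof. by rewrite /muA fineK // ge0_fin_numE // measure_ge0. Qed.

Let p0 : 0 < p. Proof. exact: lt_le_trans p1. Qed.

Let ae_filter : Filter (nbhs (almost_everywhere mu : set_system 'rV[R]_n)).
Proof. exact: (@ae_filter_ringOfSetsType _ (LebRn R n) R mu). Qed.
#[local] Existing Instance ae_filter.

Let iPhig : mu.-integrable K (EFin \o (fun s => Phi s * g s)).
Proof.
apply/integrableP; split; first exact: measurable_fun_EFin (measurable_funM mPhi mg).
rewrite (eq_integral (fun s : LebRn R n => (Phi s * g s)%:E)) // => s; rewrite inE => Ks.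
by rewrite gee0_abs // lee_fin mulr_ge0 ?Phi_ge0 ?g_ge0.
Qed.

Definition admissible (x : 'rV[R]_n -> R) :=
  measurable_fun (K : set (LebRn R n)) x /\ forall t, K t -> -r <= x t <= r.

Let nemytskii_measurable x : admissible x ->
  measurable_fun (K : set (LebRn R n)) (fun s => f s (x s)).
Proof.
by move=> [mx xr]; apply: (caratheodory_comp_measurable (@lebRn_complete R n) r0 mx).
Qed.

Let nemytskii_ge0 x s : admissible x -> K s -> 0 <= f s (x s).
Proof. by move=> [_ xr] Ks; apply: f_ge0 => //; apply: xr. Qed.

Let nemytskii_le x : admissible x -> \forall s \ae mu, K s -> f s (x s) <= g s.
Proof. by move=> [_ xr]; move: fg; apply: filterS => s h Ks; apply: h => //; apply: xr. Qed.

Let kernel_le x t : admissible x -> K t ->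
  \forall s \ae mu, K s -> `|k t s * f s (x s)| <= Phi s * f s (x s).
Proof.
move=> ax Kt; have := kPhi Kt; apply: filterS => s ks Ks.
by rewrite normrM [X in _ * X]ger0_norm ?nemytskii_ge0 // ler_wpM2r ?nemytskii_ge0 ?ks.
Qed.

Let mkf x t : admissible x -> K t ->
  measurable_fun (K : set (LebRn R n)) (fun s => k t s * f s (x s)).
Proof. by move=> ax Kt; exact: measurable_funM (mkt Kt) (nemytskii_measurable ax). Qed.

Definition mass (x : 'rV[R]_n -> R) : R := Rintegral mu K (fun s => Phi s * f s (x s)).

Let PhifPhig x : admissible x ->
  \forall s \ae mu, K s -> `|Phi s * f s (x s)| <= Phi s * g s.
Proof.
move=> ax; have := nemytskii_le ax; apply: filterS => s h Ks.
by rewrite ger0_norm ?mulr_ge0 ?nemytskii_ge0 ?Phi_ge0 // ler_wpM2l ?Phi_ge0 ?h.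
Qed.

Let mPhif x : admissible x ->
  measurable_fun (K : set (LebRn R n)) (fun s => Phi s * f s (x s)).
Proof. by move=> ax; exact: measurable_funM mPhi (nemytskii_measurable ax). Qed.

Let iPhif x : admissible x -> mu.-integrable K (EFin \o (fun s => Phi s * f s (x s))).
Proof.
move=> ax; exact: (ae_le_integrable mK (mPhif ax) iPhig (PhifPhig ax)).
Qed.

Let M := Rintegral mu K (fun s => Phi s * g s).

Lemma mass_le x : admissible x -> mass x <= M.
Proof.
move=> ax; apply: le_trans (ler_norm _) _.
exact: (ae_normr_le_Rintegral mK (mPhif ax) iPhig (PhifPhig ax)).
Qed.

Definition hammerstein (x : 'rV[R]_n -> R) (t : 'rV[R]_n) : R :=
  Rintegral mu K (fun s => k t s * f s (x s)).

Lemma hammerstein_integrable x t : admissible x -> K t ->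
  mu.-integrable K (EFin \o (fun s => k t s * f s (x s))).
Proof.
move=> ax Kt.
exact: (ae_le_integrable mK (mkf ax Kt) (iPhif ax) (kernel_le ax Kt)).
Qed.

Lemma hammersteinE x t : admissible x -> K t ->
  (hammerstein x t)%:E = (\int[mu]_(s in K) (k t s * f s (x s))%:E)%E.
Proof.
move=> ax Kt; rewrite /hammerstein /Rintegral fineK //.
exact: (integrable_fin_num mK (hammerstein_integrable ax Kt)).
Qed.

Lemma hammerstein_le_mass x t : admissible x -> K t -> `|hammerstein x t| <= mass x.
Proof.
move=> ax Kt.
exact: (ae_normr_le_Rintegral mK (mkf ax Kt) (iPhif ax) (kernel_le ax Kt)).
Qed.

Definition modulus (t tau : 'rV[R]_n) : R :=
  Rintegral mu K (fun s => `|k t s - k tau s| * g s).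

Let mmodulus t tau : K t -> K tau ->
  measurable_fun (K : set (LebRn R n)) (fun s => `|k t s - k tau s| * g s).
Proof.
move=> Kt Ktau; apply: measurable_funM mg.
exact: (measurableT_comp (@normr_measurable R setT) (measurable_funB (mkt Kt) (mkt Ktau))).
Qed.

Let imodulus t tau : K t -> K tau ->
  mu.-integrable K (EFin \o (fun s => `|k t s - k tau s| * g s)).
Proof.
move=> Kt Ktau; apply: (@ae_le_integrable _ _ _ mu K mK _ (fun s => 2 * (Phi s * g s))).
- exact: mmodulus.
- by have := integrableZl mK 2 iPhig.
have := kPhi Kt; have := kPhi Ktau; apply: filterS2 => s k1 k2 Ks.
rewrite ger0_norm ?mulr_ge0 ?g_ge0 // mulrA ler_wpM2r ?g_ge0 //.
rewrite (le_trans (ler_normB _ _)) // mulrDl !mul1r lerD ?k1 ?k2 //.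
Qed.

Lemma hammerstein_modulus x t tau : admissible x -> K t -> K tau ->
  `|hammerstein x t - hammerstein x tau| <= modulus t tau.
Proof.
move=> ax Kt Ktau; rewrite /hammerstein -RintegralB //; last 2 first.
  exact: hammerstein_integrable.
  exact: hammerstein_integrable.
apply: (ae_normr_le_Rintegral mK _ (imodulus Kt Ktau)).
  exact: measurable_funB (mkf ax Kt) (mkf ax Ktau).
have := nemytskii_le ax; apply: filterS => s h Ks.
rewrite -mulrBl normrM [X in _ * X]ger0_norm ?nemytskii_ge0 // ler_wpM2l ?h //.
Qed.

Lemma modulus_near tau e : K tau -> 0 < e ->
  \forall t \near tau, K t -> modulus t tau < e.
Proof.
move=> Ktau e0.
have e_nbhs : nbhs (0%:E : \bar R) [set y | (y < e%:E)%E].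
  by rewrite /nbhs /= /ereal_nbhs /=; apply: filterS (lt_nbhsl e0) => y; rewrite lte_fin.
have near_tau : \forall t \near tau, K t ->
    (\int[mu]_(s in K) (`|k t s - k tau s| * g s)%:E < e%:E)%E := k_cont Ktau e_nbhs.
apply: filterS near_tau => t h Kt.
have := h Kt; rewrite /= -[X in (X < _)%E]fineK ?lte_fin //.
exact: (integrable_fin_num mK (imodulus Kt Ktau)).
Qed.

Lemma modulus_net e : 0 < e ->
  exists N (ts : 'I_N -> 'rV[R]_n), (forall j, K (ts j)) /\
    forall t, K t -> exists j, modulus t (ts j) <= e.
Proof.
move=> e0; have : compact K by apply: bounded_closed_compact.
rewrite compact_cover => /(_ _ K (fun tau => interior [set t | K t -> modulus t tau < e])).
case=> [tau _|t Kt|D DK KD'']; first exact: open_interior.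
  by exists t => //; apply: modulus_near.
exists (size (finmap.enum_fset D)), (fun j => nth 0 (finmap.enum_fset D) j); split=> [j|t Kt].
  by have := DK (nth 0 (finmap.enum_fset D) j) (mem_nth _ (ltn_ord j)); rewrite inE.
have [tau tauD /interior_subset h] := KD'' t Kt.
have tD : tau \in finmap.enum_fset D by [].
have tlt : (index tau (finmap.enum_fset D) < size (finmap.enum_fset D))%N by rewrite index_mem.
exists (Ordinal tlt); rewrite /= nth_index //.
exact: ltW (h Kt).
Qed.

Lemma hammerstein_cvg x (u : nat -> 'rV[R]_n -> R) t : admissible x ->
  (forall j, admissible (u j)) -> (forall s, K s -> u j s @[j --> \oo] --> x s) ->
  K t -> hammerstein (u j) t @[j --> \oo] --> hammerstein x t.
Proof.
move=> ax au ux Kt.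
have [] := @dominated_convergence _ (LebRn R n) R mu K mK
  (fun j s => (k t s * f s (u j s))%:E) (fun s => (k t s * f s (x s))%:E)
  (fun s => (Phi s * g s)%:E).
- by move=> j; exact: measurable_fun_EFin (mkf (au j) Kt).
- exact: measurable_fun_EFin (mkf ax Kt).
- move: f_cont; apply: filterS => s fs Ks; apply: cvg_EFin; first exact: nearW.
  apply: cvgM; first exact: cvg_cst.
  apply/cvgrPdist_lt => e e0.
  have xs : `[-r, r]%classic (x s) by rewrite /= in_itv /=; apply: ax.2.
  have [d d0 hd] := within_continuous_dist (fs Ks) xs e0.
  have := ux s Ks; move/cvgrPdist_lt => /(_ d d0); apply: filterS => j uj.
  by apply: hd => //; rewrite /= in_itv /=; apply: (au j).2.
- exact: iPhig.
- have := kPhi Kt; move: fg; apply: filterS2 => s fs ks j Ks.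
  have au' := (au j).2 s Ks.
  rewrite lee_fin normrM [X in _ * X]ger0_norm ?f_ge0 //.
  by rewrite ler_pM ?ks ?fs ?f_ge0.
move=> iH _ cvg; rewrite /hammerstein /Rintegral; apply: fine_cvg.
rewrite fineK; first exact: cvg.
exact: (integrable_fin_num mK iH).
Qed.

Let iA_of_K (u : 'rV[R]_n -> R) : mu.-integrable K (EFin \o u) ->
  mu.-integrable A (EFin \o u).
Proof. by apply: integrableS. Qed.

Lemma hammerstein_measurable x : admissible x ->
  measurable_fun (A : set (LebRn R n)) (hammerstein x) /\
  c * mass x <= Rintegral mu A (hammerstein x).
Proof.
move=> ax.
have massE : (\int[mu]_(s in K) (Phi s * f s (x s))%:E = (mass x)%:E)%E.
  by rewrite /mass /Rintegral fineK // (integrable_fin_num mK (iPhif ax)).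
have Phif_fin : (\int[mu]_(s in K) (Phi s * f s (x s))%:E < +oo)%E.
  by rewrite massE ltry.
have [mT le_T] := lebRn_kernel_le K_closed K_bounded AK mA mk mkt
  (nemytskii_measurable ax) (fun s => nemytskii_ge0 ax) mPhi Phi_ge0 kPhi c0 Phik Phif_fin.
have mH : measurable_fun (A : set (LebRn R n)) (hammerstein x).
  by have := measurableT_comp (@fine_measurable R setT measurableT) mT.
split=> //.
have iH : mu.-integrable A (EFin \o hammerstein x).
  apply: (bounded_by_integrable mA A_fin mH (B := mass x)) => t At.
  by apply: hammerstein_le_mass => //; apply: AK.
rewrite -lee_fin; have -> : (Rintegral mu A (hammerstein x))%:E =
    (\int[mu]_(t in A) \int[mu]_(s in K) (k t s * f s (x s))%:E)%E.
  rewrite /Rintegral fineK ?(integrable_fin_num mA iH) //.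
  by apply: eq_integral => t; rewrite inE => At; rewrite hammersteinE //; apply: AK.
apply: le_trans le_T; rewrite /mass.
have -> : (\int[mu]_(s in K) (c * (Phi s * f s (x s)))%:E)%E =
    (c%:E * \int[mu]_(s in K) (Phi s * f s (x s))%:E)%E.
  by have := integralZl mK (iPhif ax) c.
by rewrite massE -EFinM.
Qed.

Lemma c_le_muA : c <= muA.
Proof.
pose h (s : 'rV[R]_n) := expR (- Phi s).
have mh : measurable_fun (K : set (LebRn R n)) h.
  apply: (measurableT_comp (@measurable_expR R)).
  exact: (measurableT_comp (@oppr_measurable R setT)).
have h0 s : K s -> 0 <= h s by move=> _; apply: expR_ge0.
have Phih_ge0 s : K s -> 0 <= Phi s * h s by move=> Ks; rewrite mulr_ge0 ?Phi_ge0 ?h0.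
have mPhih : measurable_fun (K : set (LebRn R n)) (fun s => Phi s * h s).
  exact: measurable_funM.
have Phih1 s : K s -> `|Phi s * h s| <= 1.
  move=> Ks; rewrite ger0_norm ?Phih_ge0 // /h expRN ler_pdivrMr ?expR_gt0 // mul1r.
  by apply: le_trans (expR_ge1Dx _); rewrite lerDr.
have iPhih : mu.-integrable K (EFin \o (fun s => Phi s * h s)).
  exact: (bounded_by_integrable mK K_fin mPhih Phih1).
pose C := Rintegral mu K (fun s => Phi s * h s).
have CE : (\int[mu]_(s in K) (Phi s * h s)%:E = C%:E)%E.
  by rewrite /C /Rintegral fineK // (integrable_fin_num mK iPhih).
have C0 : 0 < C.
  rewrite lt_neqAle Rintegral_ge0 // andbT; apply/negP => /eqP C0.
  have : (\int[mu]_(s in K) `|(Phi s * h s)%:E| = 0)%E.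
    have <- : (\int[mu]_(s in K) (Phi s * h s)%:E = 0)%E by rewrite CE -C0.
    by apply: eq_integral => s; rewrite inE => Ks; rewrite gee0_abs // lee_fin Phih_ge0.
  move/(ae_eq_integral_abs mu mK (measurable_fun_EFin mPhih)) => Ph0.
  have [B [mB B0 sB]] : \forall s \ae mu, ~ A s.
    move: Phi_eta2 Ph0; apply: filterS2 => s eta Ph As.
    have [/eqP] := Ph (AK As); rewrite /h mulf_eq0 (gt_eqF (expR_gt0 _)) orbF => /eqP Phi0.
    by move: (eta As); rewrite Phi0 leNgt eta2_gt0.
  move: A_pos; rewrite ltNge => /negP; apply; rewrite -B0.
  apply: (le_outer_measure (lebesgue_outerO R n)) => s As; apply: sB => /=.
  by move=> /(_ As).
have Cfin : (\int[mu]_(s in K) (Phi s * h s)%:E < +oo)%E by rewrite CE ltry.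
have [mT le_T] := lebRn_kernel_le K_closed K_bounded AK mA mk mkt mh h0 mPhi Phi_ge0
  kPhi c0 Phik Cfin.
have cCE : (\int[mu]_(s in K) (c * (Phi s * h s))%:E = (c * C)%:E)%E.
  by rewrite EFinM -CE; exact: (integralZl mK iPhih c).
have le_C t : A t -> (`|\int[mu]_(s in K) (k t s * h s)%:E| <= C%:E)%E.
  move=> At; have Kt := AK At.
  have mkh : measurable_fun (K : set (LebRn R n)) (fun s => k t s * h s).
    exact: measurable_funM (mkt Kt) mh.
  apply: le_trans (le_abse_integral mu mK (measurable_fun_EFin mkh)) _.
  rewrite -CE; apply: (ae_ge0_le_integral mK).
  - by move=> s _; exact: abse_ge0.
  - exact: (measurableT_comp (@abse_measurable R setT) (measurable_fun_EFin mkh)).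
  - by move=> s Ks; rewrite lee_fin Phih_ge0.
  - exact: measurable_fun_EFin mPhih.
  - have := kPhi Kt; apply: filterS => s ks Ks.
    by rewrite lee_fin normrM (ger0_norm (h0 s Ks)) ler_wpM2r ?h0 ?ks.
have : ((c * C)%:E <= (C * muA)%:E)%E.
  rewrite -cCE; apply: le_trans le_T _; apply: le_trans (lee_abs _) _.
  apply: le_trans (le_abse_integral mu mA mT) _.
  apply: le_trans (integral_le_bound C%:E mA mT _ _) _; rewrite ?lee_fin ?(ltW C0) //.
    by apply: aeW => t At; apply: le_C.
  by rewrite EFinM -muAE.
by rewrite lee_fin mulrC ler_pM2l.
Qed.

Definition powint (x : 'rV[R]_n -> R) : R := Rintegral mu A (fun t => `|x t| `^ p).

Let measurable_normr_powR (x : 'rV[R]_n -> R) : measurable_fun (A : set (LebRn R n)) x ->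
  measurable_fun (A : set (LebRn R n)) (fun t => `|x t| `^ p).
Proof.
move=> mx; apply: (measurableT_comp (@measurable_powR R p)).
exact: (measurableT_comp (@normr_measurable R setT) mx).
Qed.

Let normr_powR_le (x : 'rV[R]_n -> R) B t : `|x t| <= B -> `| `|x t| `^ p | <= B `^ p :> R.
Proof.
move=> xB; rewrite ger0_norm ?powR_ge0 // ge0_ler_powR ?nnegrE ?(ltW p0) //.
exact: le_trans xB.
Qed.

Let powint_integrable (x : 'rV[R]_n -> R) B : measurable_fun (A : set (LebRn R n)) x ->
  (forall t, A t -> `|x t| <= B) ->
  mu.-integrable A (EFin \o (fun t => `|x t| `^ p)).
Proof.
move=> mx xB; apply: (bounded_by_integrable mA A_fin (measurable_normr_powR mx) (B := B `^ p)).
by move=> t At; apply: normr_powR_le; apply: xB.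
Qed.

Let m_powR_muA : (m * muA `^ (- p^-1)) `^ p * muA = m `^ p.
Proof.
rewrite powRM ?powR_ge0 ?(ltW m0) // -powRrM mulNr mulVf ?gt_eqF //.
by rewrite powR_inv1 ?(ltW muA_gt0) // -mulrA mulVf ?mulr1 ?gt_eqF.
Qed.

Let m_muA_le : m * muA `^ (- p^-1) * muA <= r * c.
Proof.
have muA_p : muA `^ (- p^-1) * muA = muA `^ (1 - p^-1).
  rewrite powRD ?(gt_eqF muA_gt0) ?implybT // powRr1 ?(ltW muA_gt0) //.
  exact: mulrC.
rewrite -mulrA muA_p; apply: (@le_trans _ _ (r * c * muA `^ (- (1 - p^-1)) * muA `^ (1 - p^-1))).
  by rewrite ler_wpM2r ?powR_ge0.
by rewrite powRN -mulrA mulVf ?mulr1 // gt_eqF ?powR_gt0.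
Qed.

Definition cone_ball : set ('rV[R]_n -> R) :=
  [set x | [/\ {within K, continuous x},
    forall t, K t -> c * `|x t| <= Rintegral mu A x & powint x <= m `^ p]].

Let continuous_measurableK (x : 'rV[R]_n -> R) : {within K, continuous x} ->
  measurable_fun (K : set (LebRn R n)) x.
Proof. exact: within_continuous_measurable. Qed.

Let measurableKA (x : 'rV[R]_n -> R) : measurable_fun (K : set (LebRn R n)) x ->
  measurable_fun (A : set (LebRn R n)) x.
Proof. by apply: measurable_funS. Qed.

Lemma cone_ball_admissible x : cone_ball x -> admissible x.
Proof.
move=> [cx xI xJ]; have mx := continuous_measurableK cx; split=> // t Kt.
pose B := Rintegral mu A x / c.
have xB s : K s -> `|x s| <= B by move=> Ks; rewrite ler_pdivlMr // mulrC xI.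
have mxA := measurableKA mx.
have ix : mu.-integrable A (EFin \o x).
  by apply: (bounded_by_integrable mA A_fin mxA (B := B)) => s As; apply/xB/AK.
have le1 : Rintegral mu A (fun s => `|x s|) <= r * c.
  apply: le_trans m_muA_le; apply: (le_integral_of_powR mA A_fin (B := B) p1).
  - by rewrite mulr_gt0 ?powR_gt0.
  - exact: (measurableT_comp (@normr_measurable R setT) mxA).
  - by move=> s As; rewrite normr_ge0 xB //; apply: AK.
  - by rewrite -/muA m_powR_muA.
have : c * `|x t| <= r * c.
  apply: le_trans (xI t Kt) (le_trans (ler_norm _) (le_trans _ le1)).
  exact: le_normr_Rintegral.
by rewrite mulrC ler_pM2r // ler_norml.
Qed.

Let mass_ge0 x : admissible x -> 0 <= mass x.
Proof.
by move=> ax; apply: Rintegral_ge0 => s Ks; rewrite mulr_ge0 ?Phi_ge0 ?nemytskii_ge0.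
Qed.

Lemma mass_lower x : admissible x ->
  eta1 * eta2 * (powint x - (theta * m) `^ p) <= r `^ p * mass x.
Proof.
move=> ax; have [mx xr] := ax; have mxA := measurableKA mx.
have xr' t : A t -> `|x t| <= r by move=> At; rewrite ler_norml xr //; apply: AK.
pose rho := theta * m * muA `^ (- p^-1).
have th0 : 0 < theta by have /andP[] := theta01.
have rho0 : 0 <= rho by rewrite !mulr_ge0 ?powR_ge0 // ltW.
have rhoE : (theta * m) `^ p = rho `^ p * muA.
  rewrite (_ : rho = theta * (m * muA `^ (- p^-1))); last by rewrite /rho mulrA.
  rewrite (@powRM _ _ _ p (ltW th0) (mulr_ge0 (ltW m0) (powR_ge0 _ _))) -mulrA.
  by rewrite m_powR_muA powRM // ltW.
have iJ := powint_integrable mxA xr'.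
have icst : mu.-integrable A (EFin \o cst (rho `^ p)).
  by apply: (bounded_by_integrable mA A_fin (measurable_cst _) (B := `|rho `^ p|)).
have iAPhif := iA_of_K (iPhif ax).
have le_A : eta1 * eta2 * (powint x - (theta * m) `^ p) <=
    r `^ p * Rintegral mu A (fun s => Phi s * f s (x s)).
  have -> : (theta * m) `^ p = Rintegral mu A (cst (rho `^ p)).
    by rewrite Rintegral_cst.
  rewrite /powint -RintegralB // -RintegralZl //; last first.
    by have := integrableB mA iJ icst.
  rewrite -RintegralZl //; apply: (ae_le_Rintegral mA).
  - by have := integrableZl mA (eta1 * eta2) (integrableB mA iJ icst).
  - by have := integrableZl mA (r `^ p) iAPhif.
  move: f_eta1 Phi_eta2; apply: filterS2 => t ft Pt At /=.
  have Kt := AK At; have f0 := nemytskii_ge0 ax Kt; have P0 := Phi_ge0 Kt.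
  have rp0 : 0 <= r `^ p by apply: powR_ge0.
  have [le_rho|lt_rho] := leP rho `|x t|.
    have := ft At (x t); rewrite le_rho xr' // => /(_ isT) fe.
    have := normr_powR_le (xr' t At); rewrite ger0_norm ?powR_ge0 // => xp.
    have h1 : `|x t| `^ p - rho `^ p <= r `^ p.
      by rewrite lerBlDr (le_trans xp) // lerDl powR_ge0.
    apply: (@le_trans _ _ (eta1 * eta2 * r `^ p)).
      by rewrite ler_wpM2l // mulr_ge0 // ltW.
    rewrite [leRHS]mulrC ler_wpM2r // [leRHS]mulrC.
    by rewrite ler_pM ?(ltW eta1_gt0) ?(ltW eta2_gt0) // Pt.
  apply: (@le_trans _ _ 0); last by rewrite !mulr_ge0.
  rewrite mulr_ge0_le0 ?mulr_ge0 ?(ltW eta1_gt0) ?(ltW eta2_gt0) // subr_le0.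
  by rewrite ge0_ler_powR ?nnegrE ?(ltW p0) // ltW.
apply: le_trans le_A _; rewrite ler_wpM2l ?powR_ge0 // /mass /Rintegral.
have fK := integrable_fin_num mK (iPhif ax).
have fA := integrable_fin_num mA iAPhif.
rewrite fine_le //.
apply: (@ge0_subset_integral _ _ R mu A K mA mK _ (measurable_fun_EFin (mPhif ax)) _ AK).
by move=> s Ks; rewrite lee_fin mulr_ge0 ?Phi_ge0 ?nemytskii_ge0.
Qed.

Definition shifted (x : 'rV[R]_n -> R) (t : 'rV[R]_n) : R :=
  hammerstein x t + (m `^ p - powint x).

Lemma shifted_continuous x : admissible x -> {within K, continuous (shifted x)}.
Proof.
move=> ax; apply/subspace_continuousP => tau Ktau.
apply/cvgrPdist_lt => e e0; rewrite near_withinE; near=> t => Kt.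
rewrite distrC /shifted opprD addrACA subrr addr0.
apply: le_lt_trans (hammerstein_modulus ax Kt Ktau) _.
by move: Kt; near: t; apply: modulus_near.
Unshelve. all: by end_near. Qed.

Let hammerstein_integrableA x : admissible x ->
  mu.-integrable A (EFin \o hammerstein x).
Proof.
move=> ax; have [mH _] := hammerstein_measurable ax.
apply: (bounded_by_integrable mA A_fin mH (B := mass x)) => t At.
by apply: hammerstein_le_mass => //; apply: AK.
Qed.

Let shifted_int x : admissible x ->
  Rintegral mu A (shifted x) = Rintegral mu A (hammerstein x) + (m `^ p - powint x) * muA.
Proof.
move=> ax; have -> : (m `^ p - powint x) * muA = Rintegral mu A (cst (m `^ p - powint x)).
  by rewrite Rintegral_cst.
rewrite -RintegralD //; first exact: hammerstein_integrableA.
exact: (bounded_by_integrable mA A_fin (measurable_cst _) (B := `|m `^ p - powint x|)).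
Qed.

Lemma shifted_cone x t : cone_ball x -> K t ->
  c * `|shifted x t| <= Rintegral mu A (shifted x).
Proof.
move=> Cx Kt; have ax := cone_ball_admissible Cx; have [_ _ xJ] := Cx.
rewrite shifted_int //; have [_ h1] := hammerstein_measurable ax.
have h2 := hammerstein_le_mass ax Kt.
have h3 : 0 <= m `^ p - powint x by rewrite subr_ge0.
rewrite (le_trans (ler_wpM2l (ltW c0) (ler_normD _ _))) // mulrDr (ger0_norm h3).
rewrite lerD //; first by apply: le_trans h1; rewrite ler_wpM2l // ltW.
by rewrite mulrC ler_wpM2l // c_le_muA.
Qed.

Let delta : R := Num.min (c * eta1 * eta2 / r `^ p) muA * (m `^ p * (1 - theta `^ p)).

Let delta_gt0 : 0 < delta.
Proof.
have /andP[th0 th1] := theta01.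
rewrite mulr_gt0 ?lt_min ?muA_gt0 ?divr_gt0 ?mulr_gt0 ?powR_gt0 //= subr_gt0.
have one : (1 : R) `^ p = 1 by rewrite powR1.
by rewrite -[ltRHS]one gt0_ltr_powR // nnegrE ?ltW.
Qed.

Lemma shifted_int_ge x : cone_ball x -> delta <= Rintegral mu A (shifted x).
Proof.
move=> Cx; have ax := cone_ball_admissible Cx; have [_ _ xJ] := Cx.
rewrite shifted_int //; have [_ h1] := hammerstein_measurable ax.
apply: le_trans (lerD h1 (lexx _)).
have := mass_lower ax; have B0 := mass_ge0 ax; have /andP[th0 th1] := theta01.
rewrite powRM ?(ltW th0) ?(ltW m0) //.
rewrite /delta; set b := Num.min _ _.
have b1 : b <= c * eta1 * eta2 / r `^ p by rewrite ge_min lexx.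
have b2 : b <= muA by rewrite ge_min lexx orbT.
have b0 : 0 < b.
  by rewrite lt_min muA_gt0 divr_gt0 ?mulr_gt0 ?powR_gt0.
have rp0 : 0 < r `^ p by apply: powR_gt0.
move: b1; rewrite ler_pdivlMr // => b1.
set J := powint x; set mp := m `^ p; set th := theta `^ p => mass_ge.
have h3 : b * (mp - J) <= (mp - J) * muA.
  by rewrite mulrC ler_wpM2l // subr_ge0.
apply: le_trans (lerD (lexx (c * mass x)) h3).
have [le_J|lt_J] := leP (th * mp) J.
  have h4 : b * (J - th * mp) <= c * mass x.
    rewrite -(ler_pM2r rp0); apply: (@le_trans _ _ (c * eta1 * eta2 * (J - th * mp))).
      by rewrite mulrAC ler_wpM2r // subr_ge0.
    rewrite -!mulrA ler_wpM2l ?(ltW c0) // !mulrA.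
    by rewrite [leRHS]mulrC.
  apply: le_trans (lerD h4 (lexx _)); rewrite -mulrDr ler_wpM2l ?(ltW b0) //.
  by rewrite le_eqVlt; apply/orP; left; apply/eqP; ring.
apply: (@le_trans _ _ (b * (mp - J))); last by rewrite lerDr mulr_ge0 // ltW.
by rewrite ler_wpM2l ?(ltW b0) // mulrBr mulr1 lerD2l lerN2 mulrC ltW.
Qed.

Let kappa : R := (delta / (2 * muA)) `^ p * muA.

Let kappa_gt0 : 0 < kappa.
Proof. by rewrite mulr_gt0 // powR_gt0 // divr_gt0 // mulr_gt0. Qed.

Let shifted_measurable x : admissible x ->
  measurable_fun (A : set (LebRn R n)) (shifted x).
Proof.
by move=> ax; exact: measurableKA (continuous_measurableK (shifted_continuous ax)).
Qed.

Let shifted_bound x t : cone_ball x -> K t -> `|shifted x t| <= M + m `^ p.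
Proof.
move=> Cx Kt; have ax := cone_ball_admissible Cx; have [_ _ xJ] := Cx.
rewrite (le_trans (ler_normD _ _)) // lerD //.
  exact: le_trans (hammerstein_le_mass ax Kt) (mass_le ax).
rewrite ger0_norm ?subr_ge0 // gerBl.
by apply: Rintegral_ge0 => s _; apply: powR_ge0.
Qed.

Lemma shifted_powint_gt x : cone_ball x -> kappa < powint (shifted x).
Proof.
move=> Cx; have ax := cone_ball_admissible Cx; have mS := shifted_measurable ax.
have bS t : A t -> `|shifted x t| <= M + m `^ p.
  by move=> At; apply: shifted_bound => //; apply: AK.
rewrite ltNge; apply/negP => le_k.
have iS := bounded_by_integrable mA A_fin mS bS.
have v0 : 0 < delta / (2 * muA) by rewrite divr_gt0 // mulr_gt0.
have mnS := measurableT_comp (@normr_measurable R setT) mS.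
have := le_integral_of_powR mA A_fin (B := M + m `^ p) p1 v0 mnS
  (fun t At => introT andP (conj (normr_ge0 _) (bS t At))) le_k.
have -> : delta / (2 * muA) * fine (mu A) = delta / 2.
  by rewrite -/muA invfM mulrA divfK // gt_eqF.
move=> le1; have le2 := le_trans (le_normr_Rintegral mA iS) le1.
have := le_trans (shifted_int_ge Cx) (le_trans (ler_norm _) le2).
by have := delta_gt0; lra.
Qed.

Definition normalised (x : 'rV[R]_n -> R) (t : 'rV[R]_n) : R :=
  m / powint (shifted x) `^ p^-1 * shifted x t.

Let normaliser_gt0 x : cone_ball x -> 0 < m / powint (shifted x) `^ p^-1.
Proof.
move=> Cx; rewrite divr_gt0 // powR_gt0 //.
exact: lt_trans kappa_gt0 (shifted_powint_gt Cx).
Qed.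

Lemma normalised_powint x : cone_ball x -> powint (normalised x) = m `^ p.
Proof.
move=> Cx; have ax := cone_ball_admissible Cx; have mS := shifted_measurable ax.
have J0 : 0 < powint (shifted x) := lt_trans kappa_gt0 (shifted_powint_gt Cx).
have a0 := normaliser_gt0 Cx.
have iJ := powint_integrable mS (fun t At => shifted_bound Cx (AK At)).
have -> : powint (normalised x) =
    (m / powint (shifted x) `^ p^-1) `^ p * powint (shifted x).
  transitivity (Rintegral mu A (fun t =>
      (m / powint (shifted x) `^ p^-1) `^ p * `|shifted x t| `^ p)).
    apply: eq_Rintegral => t _.
    by rewrite /normalised normrM (gtr0_norm a0) (@powRM _ _ _ p (ltW a0)).
  by rewrite RintegralZl.
rewrite powRM ?invr_ge0 ?powR_ge0 ?(ltW m0) //.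
have -> : (powint (shifted x) `^ p^-1)^-1 `^ p = (powint (shifted x))^-1.
  rewrite -powRN -powRrM mulNr mulVf ?gt_eqF //.
  by rewrite powR_inv1 ?(ltW J0).
by rewrite divfK // gt_eqF.
Qed.

Lemma normalised_cone x : cone_ball x -> cone_ball (normalised x).
Proof.
move=> Cx; have ax := cone_ball_admissible Cx; have a0 := normaliser_gt0 Cx.
have iS := bounded_by_integrable mA A_fin (shifted_measurable ax)
  (fun t At => shifted_bound Cx (AK At)).
split; last by rewrite normalised_powint.
- apply/subspace_continuousP => tau Ktau; apply: cvgM; first exact: cvg_cst.
  by have /subspace_continuousP/(_ tau Ktau) := shifted_continuous ax.
- move=> t Kt; rewrite /normalised normrM (gtr0_norm a0) RintegralZl //.
  by rewrite mulrCA ler_wpM2l ?(ltW a0) // shifted_cone.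
Qed.

Lemma cone_ball_convex (a : R) x y : 0 <= a <= 1 -> cone_ball x -> cone_ball y ->
  cone_ball (fun t => a * x t + (1 - a) * y t).
Proof.
move=> a01 Cx Cy; have /andP[a0 a1] := a01.
have b0 : 0 <= 1 - a by rewrite subr_ge0.
have [mx xr] := cone_ball_admissible Cx; have [my yr] := cone_ball_admissible Cy.
have bx t : A t -> `|x t| <= r by move=> At; rewrite ler_norml xr //; apply: AK.
have yB t : A t -> `|y t| <= r by move=> At; rewrite ler_norml yr //; apply: AK.
have mxA := measurableKA mx; have myA := measurableKA my.
have ix := bounded_by_integrable mA A_fin mxA bx.
have iy := bounded_by_integrable mA A_fin myA yB.
have iJx := powint_integrable mxA bx; have iJy := powint_integrable myA yB.
have iax := integrableZl mA a ix; have iby := integrableZl mA (1 - a) iy.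
have iaJ := integrableZl mA a iJx; have ibJ := integrableZl mA (1 - a) iJy.
have [cx xI xJ] := Cx; have [cy yI yJ] := Cy.
have mxy : measurable_fun (A : set (LebRn R n)) (fun t => a * x t + (1 - a) * y t).
  apply: measurable_funD; apply: measurable_funM => //; exact: measurable_cst.
have bxy t : A t -> `|a * x t + (1 - a) * y t| <= r.
  move=> At; rewrite (le_trans (ler_normD _ _)) // !normrM (ger0_norm a0) (ger0_norm b0).
  rewrite (_ : r = a * r + (1 - a) * r); last by ring.
  by rewrite lerD // ler_wpM2l // ?bx ?yB.
split.
- apply/subspace_continuousP => tau Ktau; apply: cvgD; apply: cvgM;
    try exact: cvg_cst.
    by have /subspace_continuousP/(_ tau Ktau) := cx.
  by have /subspace_continuousP/(_ tau Ktau) := cy.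
- move=> t Kt; rewrite RintegralD // RintegralZl // RintegralZl //.
  rewrite (le_trans (ler_wpM2l (ltW c0) (ler_normD _ _))) // mulrDr.
  rewrite !normrM (ger0_norm a0) (ger0_norm b0) [c * _]mulrCA [X in _ + X]mulrCA.
  by rewrite lerD // ler_wpM2l // ?xI ?yI.
- apply: (@le_trans _ _ (a * powint x + (1 - a) * powint y)); last first.
    rewrite (_ : m `^ p = a * m `^ p + (1 - a) * m `^ p); last by ring.
    exact: lerD (ler_wpM2l a0 xJ) (ler_wpM2l b0 yJ).
  rewrite /powint -RintegralZl // -RintegralZl // -RintegralD //.
  apply: le_Rintegral => //; first exact: powint_integrable mxy bxy.
    by have := integrableD mA iaJ ibJ.
  by move=> t At; apply: convex_normr_powR.
Qed.

Let rate_cvg (u : nat -> R) (l : R) : (forall j, `|u j - l| <= j.+1%:R^-1) ->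
  u j @[j --> \oo] --> l.
Proof.
move=> ul; apply/cvgrPdist_le => e e0; exists (Num.truncn e^-1) => // j /= je.
rewrite distrC (le_trans (ul j)) // invf_ple ?posrE ?ltr0n //.
by rewrite ltW // (lt_le_trans (truncnS_gt _)) // ler_nat ltnS.
Qed.

Let powint_cvg (u : nat -> 'rV[R]_n -> R) x B :
  (forall j, measurable_fun (A : set (LebRn R n)) (u j)) ->
  (forall j t, A t -> `|u j t| <= B) -> (forall t, A t -> u j t @[j --> \oo] --> x t) ->
  powint (u j) @[j --> \oo] --> powint x.
Proof.
move=> mu uB ux; apply: (bounded_convergence mA A_fin (B := B `^ p)).
- by move=> j; apply: measurable_normr_powR.
- by move=> j t At; apply: normr_powR_le; apply: uB.
- by move=> t At; apply: (continuous_cvg _ (@continuous_normr_powR R p p0 (x t))); apply: ux.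
Qed.

Lemma cone_ball_closed x (u : nat -> 'rV[R]_n -> R) : (forall j, cone_ball (u j)) ->
  (forall j t, K t -> `|u j t - x t| <= j.+1%:R^-1) -> cone_ball x.
Proof.
move=> Cu ux.
have ur j t : K t -> `|u j t| <= r.
  by move=> Kt; have [_ h] := cone_ball_admissible (Cu j); rewrite ler_norml h.
have muj j : measurable_fun (A : set (LebRn R n)) (u j).
  by have [h _] := cone_ball_admissible (Cu j); apply: measurableKA.
have uxt t : K t -> u j t @[j --> \oo] --> x t.
  by move=> Kt; apply: rate_cvg => j; apply: ux.
split.
- apply/subspace_continuousP => tau Ktau; apply/cvgrPdist_lt => e e0.
  have e30 : 0 < e / 3 by rewrite divr_gt0.
  have [j hj] : exists j : nat, j.+1%:R^-1 <= e / 3.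
    exists (Num.truncn (e / 3)^-1); rewrite invf_ple ?posrE ?ltr0n //.
    by rewrite ltW // truncnS_gt.
  have [/subspace_continuousP/(_ tau Ktau) + _ _] := Cu j.
  move=> /cvgrPdist_lt/(_ _ e30); rewrite !near_withinE; apply: filterS => t h Kt.
  have := h Kt; have := le_trans (ux j t Kt) hj; have := le_trans (ux j tau Ktau) hj.
  rewrite !ler_norml !ltr_norml /from_subspace.
  move=> /andP[h1 h2] /andP[h3 h4] /andP[h5 h6].
  by apply/andP; split; lra.
- move=> t Kt.
  have cI : Rintegral mu A (u j) @[j --> \oo] --> Rintegral mu A x.
    by apply: (bounded_convergence mA A_fin muj (B := r)) => [j s As|s As];
      [apply/ur/AK|apply/uxt/AK].
  have cc : c * `|u j t| @[j --> \oo] --> c * `|x t|.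
    by apply: cvgM; [exact: cvg_cst|apply: cvg_norm; apply: uxt].
  apply: (ler_cvg_to cc cI); apply: nearW => j.
  by have [_ h _] := Cu j; apply: h.
- have cJ := powint_cvg muj (fun j t At => ur j t (AK At)) (fun t At => uxt t (AK At)).
  apply: (ler_cvg_to cJ (cvg_cst (m `^ p))); apply: nearW => j.
  by have [_ _ h] := Cu j.
Qed.

Lemma normalised_cvg x (u : nat -> 'rV[R]_n -> R) t : cone_ball x ->
  (forall j, cone_ball (u j)) -> (forall s, K s -> u j s @[j --> \oo] --> x s) ->
  K t -> normalised (u j) t @[j --> \oo] --> normalised x t.
Proof.
move=> Cx Cu ux Kt.
have ax := cone_ball_admissible Cx.
have au j := cone_ball_admissible (Cu j).
have cJ : powint (u j) @[j --> \oo] --> powint x.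
  apply: (powint_cvg (B := r)) => [j|j s As|s As].
  - exact: measurableKA (au j).1.
  - by rewrite ler_norml (au j).2 //; apply: AK.
  - by apply/ux/AK.
have cS s : K s -> shifted (u j) s @[j --> \oo] --> shifted x s.
  move=> Ks; apply: cvgD; first exact: hammerstein_cvg.
  by apply: cvgB => //; exact: cvg_cst.
have cJS : powint (shifted (u j)) @[j --> \oo] --> powint (shifted x).
  apply: (powint_cvg (B := M + m `^ p)) => [j|j s As|s As].
  - exact: shifted_measurable (au j).
  - exact: shifted_bound (Cu j) (AK As).
  - by apply/cS/AK.
have J_ge0 y : 0 <= powint y by apply: Rintegral_ge0 => s _; apply: powR_ge0.
apply: cvgM; last exact: cS.
apply: cvgM; first exact: cvg_cst.
apply: cvgV.
  by rewrite gt_eqF // powR_gt0 // (lt_trans kappa_gt0 (shifted_powint_gt Cx)).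
by apply: cvg_powR => //; rewrite invr_gt0.
Qed.

Theorem hammerstein_solution : exists lambda : R, 0 < lambda /\
  exists x : 'rV[R]_n -> R,
    [/\ {within K, continuous x}, forall t, K t -> -r <= x t <= r,
      forall t, K t ->
        (lambda * x t)%:E = (\int[mu]_(s in K) (k t s * f s (x s))%:E)%E &
      ((\int[mu]_(t in A) (`|x t| `^ p)%:E) `^ p^-1)%E = m%:E].
Proof.
have C0 : cone_ball (cst 0).
  split; first by move=> t; apply: cvg_cst.
    by move=> t _; rewrite normr0 mulr0 Rintegral_ge0.
  have -> : powint (cst 0) = Rintegral mu A (cst 0).
    by apply: eq_Rintegral => t _; rewrite /= normr0 powR0 // gt_eqF.
  by rewrite Rintegral_cst // mul0r powR_ge0.
have kp0 : 0 < kappa `^ p^-1 by rewrite powR_gt0.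
have [x Cx fix_x] : exists2 x, cone_ball x & forall t, K t -> normalised x t = x t.
  apply: (@schauder R _ K cone_ball normalised r).
  - by exists (cst 0).
  - by apply: convex_combination => a x y; apply: cone_ball_convex.
  - by move=> x u; apply: cone_ball_closed.
  - exact: normalised_cone.
  - move=> x Cx t Kt; have [_ h] := cone_ball_admissible (normalised_cone Cx).
    by rewrite ler_norml h.
  - move=> e e0; have e'0 : 0 < e * kappa `^ p^-1 / m by rewrite divr_gt0 // mulr_gt0.
    have [N [ts [tsK tsP]]] := modulus_net e'0.
    exists N, ts; split=> // t Kt; have [j tj] := tsP t Kt; exists j => x Cx.
    have ax := cone_ball_admissible Cx; have a0 := normaliser_gt0 Cx.
    rewrite /normalised -mulrBr normrM (gtr0_norm a0).
    rewrite /shifted opprD addrACA subrr addr0.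
    apply: (@le_trans _ _ (m / kappa `^ p^-1 * (e * kappa `^ p^-1 / m))); last first.
      by rewrite le_eqVlt; apply/orP; left; apply/eqP; field; rewrite !gt_eqF.
    apply: ler_pM; rewrite ?(ltW a0) //.
      rewrite ler_wpM2l ?(ltW m0) // lef_pV2 ?posrE //; last first.
        by rewrite powR_gt0 // (lt_trans kappa_gt0 (shifted_powint_gt Cx)).
      have := shifted_powint_gt Cx; have := kappa_gt0 => k0 kJ.
      rewrite ge0_ler_powR ?nnegrE ?invr_ge0 ?(ltW p0) ?(ltW k0) ?(ltW kJ) //.
      exact: ltW (lt_trans k0 kJ).
    exact: le_trans (hammerstein_modulus ax Kt (tsK j)) tj.
  - move=> x u Cx Cu ux t Kt; apply: normalised_cvg => // s Ks.
    by apply: rate_cvg => j; apply: ux.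
have ax := cone_ball_admissible Cx.
have powint_eq y z : (forall t, K t -> y t = z t) -> powint y = powint z.
  by move=> yz; apply: eq_Rintegral => t; rewrite inE => At; rewrite yz //; apply: AK.
have xJ : powint x = m `^ p by rewrite -(normalised_powint Cx); apply: powint_eq => t /fix_x.
have xE t : K t -> x t = m / powint (shifted x) `^ p^-1 * hammerstein x t.
  by move=> Kt; rewrite -{1}fix_x // /normalised /shifted xJ subrr addr0.
exists (powint (shifted x) `^ p^-1 / m); split.
  by rewrite -invf_div invr_gt0; apply: normaliser_gt0.
exists x; split; [by case: Cx|by case: ax| |].
  move=> t Kt; rewrite -hammersteinE // {1}xE // mulrA; congr (_%:E).
  have J0 : 0 < powint (shifted x) `^ p^-1.
    by rewrite powR_gt0 // (lt_trans kappa_gt0 (shifted_powint_gt Cx)).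
  by rewrite mulrA divfK ?gt_eqF // divff ?mul1r // gt_eqF.
have mxA := measurableKA ax.1.
have bx t : A t -> `|x t| <= r by move=> At; rewrite ler_norml ax.2 //; apply: AK.
have -> : (\int[mu]_(t in A) (`|x t| `^ p)%:E = (m `^ p)%:E)%E.
  by rewrite -xJ /powint /Rintegral fineK // (integrable_fin_num mA (powint_integrable mxA bx)).
by rewrite poweR_EFin -powRrM mulfV ?gt_eqF // powRr1 // ltW.
Qed.

End Hammerstein.

Lemma bounded_closure (R : realType) n (B : set 'rV[R]_n) :
  bounded_set B -> bounded_set (closure B).
Proof.
move=> [M [Mr BM]]; exists M; split=> // N MN x.
have cN : closed [set y : 'rV[R]_n | `|y| <= N].
  have /continuous_closedP := @norm_continuous R 'rV[R]_n.
  by move=> /(_ _ (@closed_le R N)).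
have BN : B `<=` [set y : 'rV[R]_n | `|y| <= N] := BM N MN.
by move=> /(closureS BN); move/closure_id : cN => <-.
Qed.

Unset Implicit Arguments.

(* R^n = 'rV[R]_n, mu = lebRn R n (n-dimensional Lebesgue measure, Defs.v);
   f, k, g_r, Phi are total functions, only their values on
   closure Om x [-r,r] resp. closure Om x closure Om matter. *)
Theorem theorem3p3 (R : realType) (n : nat)
  (Om Om0 : set 'rV[R]_n) (r theta eta1 eta2 m c p : R)
  (f : 'rV[R]_n -> R -> R) (k : 'rV[R]_n -> 'rV[R]_n -> R)
  (g Phi : 'rV[R]_n -> R) :
  open Om -> bounded_set Om -> 0 < r ->
  Om0 `<=` closure Om ->
  measurable (Om0 : set (LebRn R n)) -> (0 < lebRn R n Om0)%E ->
  0 < theta < 1 -> 0 < eta1 -> 0 < eta2 -> 0 < m -> 0 < c -> 1 <= p ->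
  (* f : closure Om x [-r,r] -> [0,+oo) *)
  (forall t u, closure Om t -> -r <= u <= r -> 0 <= f t u) ->
  (* (1) Caratheodory conditions *)
  (forall u, -r <= u <= r ->
     measurable_fun (closure Om : set (LebRn R n)) (fun t => f t u)) ->
  (\forall t \ae lebRn R n, closure Om t ->
     {within `[-r, r], continuous (f t)}) ->
  measurable_fun (closure Om : set (LebRn R n)) g ->
  (forall t, closure Om t -> 0 <= g t) ->
  (\forall t \ae lebRn R n, closure Om t ->
     forall u, -r <= u <= r -> f t u <= g t) ->
  (* (2) *)
  (\forall t \ae lebRn R n, Om0 t ->
     forall u, theta * m * fine (lebRn R n Om0) `^ (- p^-1) <= `|u| <= r ->
       eta1 <= f t u) ->
  (* (3) *)
  measurable_fun
    ([set z | closure Om (lsubmx z) /\ closure Om (rsubmx z)]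
       : set (LebRn R (n + n)))
    (fun z : 'rV[R]_(n + n) => k (lsubmx z) (rsubmx z)) ->
  (forall tau, closure Om tau ->
     measurable_fun (closure Om : set (LebRn R n)) (k tau)) ->
  (forall tau, closure Om tau ->
     (fun t => (\int[lebRn R n]_(s in closure Om)
                  (`|k t s - k tau s| * g s)%:E)%E)
       @ within (closure Om) (nbhs tau) --> 0%E) ->
  (* (4) *)
  measurable_fun (closure Om : set (LebRn R n)) Phi ->
  (forall s, closure Om s -> 0 <= Phi s) ->
  (\forall t \ae lebRn R n, Om0 t -> eta2 <= Phi t) ->
  (forall t, closure Om t ->
     \forall s \ae lebRn R n, closure Om s -> `|k t s| <= Phi s) ->
  (\forall s \ae lebRn R n, closure Om s ->
     ((c * Phi s)%:E <= \int[lebRn R n]_(t in Om0) (k t s)%:E)%E) ->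
  (* (5) *)
  (\int[lebRn R n]_(s in closure Om) (Phi s * g s)%:E < +oo)%E ->
  (* (6): 1/q = 1 - 1/p, with q in (1,+oo] conjugate to p *)
  m <= r * c * fine (lebRn R n Om0) `^ (- (1 - p^-1)) ->
  exists lambda : R, 0 < lambda /\
    exists x : 'rV[R]_n -> R,
      [/\ {within closure Om, continuous x},
          (forall t, closure Om t -> -r <= x t <= r),
          (forall t, closure Om t ->
             (lambda * x t)%:E =
               (\int[lebRn R n]_(s in closure Om) (k t s * f s (x s))%:E)%E) &
          ((\int[lebRn R n]_(t in Om0) (`|x t| `^ p)%:E) `^ p^-1)%E = m%:E].
Proof.
move=> _ Om_bounded r0 AK mA A_pos theta01 eta10 eta20 m0 c0 p1 f0 mf cf mg g0 fg feta
  mk mkt ck mPhi Phi0 Phieta kPhi Phik Phig m_le.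
exact: (hammerstein_solution (@closed_closure _ Om) (bounded_closure Om_bounded) r0 AK
  mA A_pos theta01 eta10 eta20 m0 c0 p1 f0 mf cf mg g0 fg feta mk mkt ck mPhi Phi0
  Phieta kPhi Phik Phig m_le).
Qed.
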